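(* Let $n\ge 2$, let $\Gamma=F(A_1,\dots,A_n)$ be the free group on $n$ generators, let $\Gamma_c\subset\Gamma$ be the set of cyclically reduced words, and let $1\le j\le n$. Let $\mathrm{wl}(\gamma)$ denote the word length of $\gamma$, let $\log_j:\Gamma\to\mathbb{Z}$ be the homomorphism with $\log_j(A_i)=\delta_{ij}$, and put $$\mathfrak{log}_j(\gamma)=\sqrt{\frac{n-1}{\mathrm{wl}(\gamma)}}\,\log_j(\gamma).$$ Then on $\Gamma_c$ the function $\mathfrak{log}_j$ has asymptotically a standard Gaussian distribution: for all real $a\le b$, $$\frac{\#\{\gamma\in\Gamma_c \mid \mathrm{wl}(\gamma)\le l,\ \mathfrak{log}_j(\gamma)\in[a,b]\}}{\#\{\gamma\in\Gamma_c\mid \mathrm{wl}(\gamma)\le l\}}\longrightarrow \frac{1}{\sqrt{2\pi}}\int_a^b \exp\left(-\frac{x^2}{2}\right)dx\quad\text{as } l\to\infty .$$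
   Context: Every $\gamma\in\Gamma$ is uniquely represented by a reduced word $\gamma=\prod_{i=1}^k A_{m_i}^{\epsilon_i}$ with $m_i\in\{1,\dots,n\}$, $\epsilon_i\in\{\pm1\}$, where there is no $i_0$ with $m_{i_0}=m_{i_0+1}$ and $\epsilon_{i_0}\epsilon_{i_0+1}=-1$. The word length is $\mathrm{wl}(\gamma)=k$. The element $\gamma$ is cyclically reduced if the concatenation of its reduced word with itself is again a reduced word (for $k\ge1$ equivalently: $\epsilon_1\epsilon_k\ne-1$ or $m_1\neq m_k$). The value $\log_j(\gamma)$ is the number of occurrences, counted with sign, of the generator $A_j$ in the word. For the identity element (word length $0$) one sets $\mathfrak{log}_j=0$; this single element does not affect the limit. *)

(* Defs.v *)
From HB Require Import structures.
From mathcomp Require Import all_boot all_order all_algebra.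
From mathcomp Require Import finmap.
From mathcomp Require Import all_classical all_reals all_analysis.

Set Implicit Arguments.
Unset Strict Implicit.
Unset Printing Implicit Defensive.

Import Order.TTheory GRing.Theory Num.Theory.

(* The letter (i, true) stands for A_i, and (i, false) for A_i^-1. *)
Definition letter (n : nat) : Type := ('I_n * bool)%type.
HB.instance Definition _ n := Finite.on (letter n).

Definition letter_inv n (x : letter n) : letter n := (x.1, ~~ x.2).

Definition reduced n (w : seq (letter n)) : bool :=
  sorted (fun x y => y != letter_inv x) w.

(* The free group on n generators: reduced words, multiplied by concatenation
   followed by cancellation. *)
Record freegroup (n : nat) : Type :=
  FreeGroup { word :> seq (letter n); wordP : reduced word }.

HB.instance Definition _ n := [isSub for @word n].
HB.instance Definition _ n := [Countable of freegroup n by <:].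

Definition wl n (g : freegroup n) : nat := size (word g).

Definition cyclically_reduced n (g : freegroup n) : bool :=
  reduced (word g ++ word g).

Section FreeGroupLaw.
Variable n : nat.
Implicit Types (x y : letter n) (u v w : seq (letter n)) (g h : freegroup n).

(* Reduced form of the word x :: w, for reduced w. *)
Definition push x w : seq (letter n) :=
  if w is y :: w' then if y == letter_inv x then w' else x :: w else [:: x].

Lemma letter_invK : involutive (@letter_inv n).
Proof. by case=> i b; rewrite /letter_inv /= negbK. Qed.

Lemma reduced_push x w : reduced w -> reduced (push x w).
Proof.
case: w => [|y w] //= yw; case: ifP => [_|xy]; first exact: path_sorted yw.
by rewrite /= xy.
Qed.

Lemma push_reduced x w : reduced (x :: w) -> push x w = x :: w.
Proof. by case: w => [|y w] //= /andP[/negPf-> _]. Qed.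

Lemma pushVK x w : reduced w -> push x (push (letter_inv x) w) = w.
Proof.
case: w => [|y w] /=; first by rewrite eqxx.
rewrite letter_invK; case: eqP => [-> | _] yw; last by rewrite /= eqxx.
exact: push_reduced.
Qed.

Definition catr u v : seq (letter n) := foldr push v u.

Lemma reduced_catr u v : reduced v -> reduced (catr u v).
Proof. by move=> rv; elim: u => //= x u; apply: reduced_push. Qed.

Lemma catr_push x u v : reduced u -> reduced v ->
  catr (push x u) v = push x (catr u v).
Proof.
case: u => [|y u] //= yu rv; case: eqP => // ->.
by rewrite pushVK // reduced_catr.
Qed.

Lemma catrA u v w : reduced u -> reduced v -> reduced w ->
  catr u (catr v w) = catr (catr u v) w.
Proof.
move=> + rv rw; elim: u => //= x u IHu xu.
rewrite IHu ?catr_push ?reduced_catr //; exact: path_sorted xu.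
Qed.

Lemma catr_nil u : reduced u -> catr u [::] = u.
Proof.
elim: u => //= x u IHu xu; rewrite IHu ?push_reduced //.
exact: path_sorted xu.
Qed.

Definition inv_word u : seq (letter n) := rev (map (@letter_inv n) u).

Lemma reduced_inv u : reduced u -> reduced (inv_word u).
Proof.
rewrite /reduced /inv_word rev_sorted sorted_map; apply: sub_sorted => x y /=.
by apply: contra => /eqP->; rewrite !letter_invK.
Qed.

Lemma catr_cat u v w : catr (u ++ v) w = catr u (catr v w).
Proof. exact: foldr_cat. Qed.

Lemma catVr u : reduced u -> catr (inv_word u) u = [::].
Proof.
elim: u => //= x u IHu xu.
rewrite /inv_word /= rev_cons -cats1 catr_cat /= letter_invK eqxx.
by apply: IHu; apply: path_sorted xu.
Qed.

Lemma inv_wordK u : inv_word (inv_word u) = u.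
Proof. by rewrite /inv_word map_rev revK mapK //; apply: letter_invK. Qed.

Definition fg_mul g h : freegroup n :=
  FreeGroup (reduced_catr (word g) (wordP h)).
Definition fg_one : freegroup n := @FreeGroup n [::] isT.
Definition fg_inv g : freegroup n := FreeGroup (reduced_inv (wordP g)).

Lemma fg_mulA : associative fg_mul.
Proof. by move=> g h k; apply: val_inj; rewrite /= catrA ?wordP. Qed.
Lemma fg_mul1g : left_id fg_one fg_mul.
Proof. by move=> g; apply: val_inj. Qed.
Lemma fg_mulg1 : right_id fg_one fg_mul.
Proof. by move=> g; apply: val_inj; rewrite /= catr_nil ?wordP. Qed.
Lemma fg_mulVg : left_inverse fg_one fg_inv fg_mul.
Proof. by move=> g; apply: val_inj; rewrite /= catVr ?wordP. Qed.
Lemma fg_mulgV : right_inverse fg_one fg_inv fg_mul.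
Proof.
move=> g; apply: val_inj; rewrite /= -{1}[word g]inv_wordK.
by rewrite catVr // reduced_inv ?wordP.
Qed.

HB.instance Definition _ := isGroup.Build (freegroup n)
  fg_mulA fg_mul1g fg_mulg1 fg_mulVg fg_mulgV.

End FreeGroupLaw.

Definition gen n (i : 'I_n) : freegroup n :=
  @FreeGroup n [:: (i, true)] isT.

Section UniversalProperty.
Variable n : nat.
Local Open Scope group_scope.

Definition lift_letter (G : groupType) (f : 'I_n -> G) (x : letter n) : G :=
  if x.2 then f x.1 else (f x.1)^-1.

Definition fg_lift (G : groupType) (f : 'I_n -> G) (g : freegroup n) : G :=
  \prod_(x <- word g) lift_letter f x.

Lemma lift_letterV (G : groupType) (f : 'I_n -> G) x :
  lift_letter f (letter_inv x) = (lift_letter f x)^-1.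
Proof. by case: x => i []; rewrite /lift_letter //= invgK. Qed.

Lemma prod_push (G : groupType) (f : 'I_n -> G) x w :
  \prod_(y <- push x w) lift_letter f y =
  lift_letter f x * \prod_(y <- w) lift_letter f y.
Proof.
case: w => [|y w] /=; first by rewrite big_seq1 big_nil mulg1.
by case: eqP => [->|_]; rewrite !big_cons // lift_letterV mulVKg.
Qed.

Lemma fg_liftM (G : groupType) (f : 'I_n -> G) :
  {morph fg_lift f : g h / g * h}.
Proof.
move=> g h; rewrite /fg_lift /=; elim: (word g) => [|x u IHu] /=.
  by rewrite big_nil mul1g.
by rewrite prod_push IHu big_cons mulgA.
Qed.

Lemma fg_lift_gen (G : groupType) (f : 'I_n -> G) i : fg_lift f (gen i) = f i.
Proof. by rewrite /fg_lift /= big_seq1. Qed.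

Lemma fg_lift_id g : fg_lift (@gen n) g = g.
Proof.
case: g => u; rewrite /fg_lift /=; elim: u => [|x u IHu] ru.
  by rewrite big_nil; apply: val_inj.
rewrite big_cons (IHu (path_sorted ru)); apply: val_inj.
suff E : word (lift_letter (@gen n) x) = [:: x] by rewrite /= E /= push_reduced.
by case: x {ru} => i [].
Qed.

Lemma fg_lift_uniq (G : groupType) (f : 'I_n -> G) (F : freegroup n -> G) :
  {morph F : g h / g * h} -> (forall i, F (gen i) = f i) -> F =1 fg_lift f.
Proof.
move=> FM Fg g; have F1 : F 1 = 1.
  by apply: (mulgI (F 1)); rewrite -FM !mulg1.
have FV h : F h^-1 = (F h)^-1.
  by apply: (mulgI (F h)); rewrite -FM !mulgV.
rewrite -{1}(fg_lift_id g) /fg_lift (big_morph F FM F1).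
by apply: eq_bigr => x _; rewrite /lift_letter; case: ifP; rewrite ?FV Fg.
Qed.

End UniversalProperty.

Local Open Scope ring_scope.

(* Signed number of occurrences of A_j in the reduced word: the homomorphism
   log_j, which thus exists. *)
Definition signed_count n (j : 'I_n) (g : freegroup n) : int :=
  \sum_(x <- word g) (if x.1 == j then if x.2 then 1 else -1 else 0).

Lemma signed_countM n (j : 'I_n) :
  {morph signed_count j : g h / (g * h)%g >-> g + h}.
Proof.
move=> g h; rewrite /signed_count /=; elim: (word g) => [|x u IHu] /=.
  by rewrite big_nil add0r.
rewrite [in RHS]big_cons -addrA -IHu.
case: (catr u (word h)) => [|y w] /=; first by rewrite big_seq1 big_nil addr0.
case: eqP => [->|_]; rewrite !big_cons //= addrA.
by case: x => i [] /=; case: ifP; rewrite ?addr0 ?subrr ?addNr ?add0r.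
Qed.

Lemma signed_count_gen n (j i : 'I_n) : signed_count j (gen i) = (i == j)%:R.
Proof. by rewrite /signed_count /= big_seq1; case: eqP. Qed.

(* For the identity the division by 0 gives 0, hence the value 0. *)
Definition normalized_log (R : realType) n (log : freegroup n -> int)
    (g : freegroup n) : R :=
  Num.sqrt ((n%:R - 1) / (wl g)%:R) * (log g)%:~R.

(* Number of elements of a finite set; on infinite sets the value is junk (0),
   but only subsets of balls are counted, see finite_ball. *)
Definition count_set (T : choiceType) (A : set T) : nat := #|` fset_set A|.

Local Open Scope classical_set_scope.

Lemma finite_ball n l : finite_set [set g : freegroup n | (wl g <= l)%N].
Proof.
pose W : set (seq (letter n)) :=
  \bigcup_(k in `I_l.+1) (@tval k (letter n) @` [set: k.-tuple (letter n)]).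
have finW : finite_set W.
  apply: bigcup_finite; first exact: finite_II.
  by move=> k _; apply: finite_image.
have inj : {in (@word n) @^-1` W &, injective (@word n)}.
  by move=> g h _ _ gh; apply: val_inj.
apply: sub_finite_set (finite_preimage inj finW).
by move=> g /= gl; exists (wl g); [rewrite /= ltnS | exists (in_tuple (word g))].
Qed.

(* Main.v *)
Require Import Defs.
From mathcomp Require Import all_boot all_order all_algebra.
From mathcomp Require Import all_classical all_reals all_analysis.
From mathcomp Require Import measurable_realfun complex ring lra.
Import Order.TTheory GRing.Theory Num.Theory.
Import numFieldNormedType.Exports.
Local Open Scope classical_set_scope.
Local Open Scope ring_scope.

Set Implicit Arguments.
Unset Strict Implicit.
Unset Printing Implicit Defensive.

(* Give the letter x the weight exp(i t eps(x)), where eps(x) is its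
   contribution to log_j.  Summing exp(i t log_j) over the cyclically reduced
   words of length k gives the trace of the k-th power of a transfer operator,
   and this trace is lam^k + mu^k + (n-1)(1 + (-1)^k), where
   lam + mu = 2(n - 1 + cos t) and lam mu = 2n - 1.  At t = 0 the roots are
   2n - 1 and 1.  Rescaling t to t sqrt((n-1)/k) and dividing by the number of
   words gives a characteristic function tending to exp(-t^2/2), because
   lam/(2n-1) = 1 - t^2/(2k) + o(1/k).  Convergence of the characteristic
   functions is turned into convergence of interval frequencies by Gaussian
   smoothing, and the ball is handled by a weighted Cesaro mean over k. *)

(** * Gaussian densities and their Fourier transform *)

(** The normalisation of log_j depends on the word length, so the Gaussian limit is proved for each
    length separately, where the scaling is one constant and can be absorbed into the frequency t.
    Cyclic reducedness is what produces a trace: w is cyclically reduced exactly when it is a closed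
    path in the graph on the 2n letters in which no letter is followed by its inverse. The transfer
    operator is a rank-one operator minus a twisted flip of square 1; this accounts for the
    eigenvalues 1 and -1, each n - 1 times, beside lam and mu. Nothing is diagonalised: the square
    of the flip gives a two-step recursion for the trace, whose inhomogeneous part only involves the
    orbit of the constant function. The factor n - 1 of the normalisation is the one that makes the
    limit standard, because at a small frequency theta the relative defect 1 - lam/(2n - 1) is about
    theta^2 / (2(n - 1)). *)

Lemma integrable_dominated (R : realType) (D : set R) (f g : R -> R) :
  measurable D -> measurable_fun D f -> (forall x, D x -> `|f x| <= g x) ->
  lebesgue_measure.-integrable D (EFin \o g) ->
  lebesgue_measure.-integrable D (EFin \o f).
Proof.
move=> mD mf fg; apply: le_integrable => //; first exact/measurable_EFinP.
move=> x Dx /=; rewrite lee_fin (le_trans (fg x Dx))//.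
exact: ler_norm.
Qed.

Lemma Rintegral_dominated_cvg (R : realType) (D : set R)
    (f_ : nat -> R -> R) (f g : R -> R) :
  measurable D -> (forall n, measurable_fun D (f_ n)) ->
  (forall x, D x -> f_ n x @[n --> \oo] --> f x) ->
  lebesgue_measure.-integrable D (EFin \o g) ->
  (forall n x, D x -> `|f_ n x| <= g x) ->
  \int[lebesgue_measure]_(x in D) f_ n x @[n --> \oo] -->
  \int[lebesgue_measure]_(x in D) f x.
Proof.
move=> mD mf_ f_f ig f_g.
have mE n : measurable_fun D (EFin \o f_ n) by exact/measurable_EFinP.
have cE x : D x -> (EFin \o f_ n) x @[n --> \oo] --> (EFin \o f) x.
  by move=> Dx; apply: cvg_EFin; [exact: nearW|exact: f_f].
have fE n x : D x -> (`|(EFin \o f_ n) x| <= (EFin \o g) x)%E.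
  by move=> Dx; rewrite lee_fin f_g.
have mf : measurable_fun D (EFin \o f) := emeasurable_fun_cvg _ _ mE cE.
have [|||||ix _ cvgI] := @dominated_convergence _ _ _ lebesgue_measure D mD
  (fun n => EFin \o f_ n) (EFin \o f) (EFin \o g); [by []..| |by []| |].
- exact: aeW.
- by apply: aeW => x n; exact: fE.
apply: fine_cvg; rewrite fineK//; exact: integrable_fin_num.
Qed.

(** The parameter is the variance, not the deviation, because smoothing adds variances: the kernel
    [gauss v] turns the limit law into [gauss (1 + v)]. *)
Definition gauss (R : realType) (v x : R) : R :=
  (Num.sqrt (2 * pi * v))^-1 * expR (- (x ^+ 2 / (2 * v))).

Section Gauss.
Variable R : realType.
Implicit Types v x t : R.
Notation mu := (@lebesgue_measure R).

Lemma gauss_normal_pdf v : 0 < v -> gauss v = normal_pdf 0 (Num.sqrt v).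
Proof.
move=> v0; apply/funext => x.
rewrite normal_pdfE ?gt_eqF ?sqrtr_gt0// /normal_peak /normal_fun /gauss.
rewrite sqr_sqrtr ?(ltW v0)// subr0 mulNr.
by congr ((Num.sqrt _)^-1 * expR (- (_ / _))); ring.
Qed.

Lemma gauss_ge0 v x : 0 <= gauss v x.
Proof. by rewrite mulr_ge0 ?invr_ge0 ?sqrtr_ge0 ?expR_ge0. Qed.

Lemma gaussN v x : gauss v (- x) = gauss v x.
Proof. by rewrite /gauss sqrrN. Qed.

Lemma continuous_gauss v : 0 < v -> continuous (gauss v).
Proof.
by move=> v0; rewrite gauss_normal_pdf//; apply: continuous_normal_pdf;
  rewrite gt_eqF ?sqrtr_gt0.
Qed.

Lemma measurable_gauss v (D : set R) : 0 < v -> measurable_fun D (gauss v).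
Proof.
by move=> v0; rewrite gauss_normal_pdf//; apply: measurable_funTS;
  exact: measurable_normal_pdf.
Qed.

Lemma integrable_gauss v : 0 < v -> mu.-integrable setT (EFin \o gauss v).
Proof. by move=> v0; rewrite gauss_normal_pdf//; exact: integrable_normal_pdf. Qed.

Lemma integral_gauss v : 0 < v -> \int[mu]_x gauss v x = 1.
Proof.
by move=> v0; rewrite gauss_normal_pdf// /Rintegral integral_normal_pdf.
Qed.

Lemma integrable_gauss_shift v y : 0 < v ->
  mu.-integrable setT (EFin \o (fun x => gauss v (x - y))).
Proof.
move=> v0; have := integrable_normal_pdf y (Num.sqrt v).
congr (_.-integrable _ _); apply/funext => x /=; congr EFin.
rewrite gauss_normal_pdf// !normal_pdfE ?gt_eqF ?sqrtr_gt0//.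
by rewrite /normal_fun subr0.
Qed.

Lemma integral_gauss_shift v y : 0 < v -> \int[mu]_x gauss v (x - y) = 1.
Proof.
move=> v0; rewrite /Rintegral -[RHS](_ : fine 1%:E = _)//.
rewrite -(integral_normal_pdf y (Num.sqrt v)); congr fine.
apply: eq_integral => x _; congr EFin.
rewrite gauss_normal_pdf// !normal_pdfE ?gt_eqF ?sqrtr_gt0//.
by rewrite /normal_fun subr0.
Qed.

(** Half of the exponent is split off and the other half is a Gaussian of doubled variance. The free
    factor pays for a power of x in [ler_norm_gauss] and for a tail in [gauss_tail], while what
    remains is still integrable. *)
Lemma gauss_double v x : 0 < v ->
  gauss v x = Num.sqrt 2 * expR (- (x ^+ 2 / (4 * v))) * gauss (2 * v) x.
Proof.
move=> v0; have pi0 := pi_gt0 R; rewrite /gauss.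
rewrite [X in _ = X](_ : _ = (Num.sqrt 2 * (Num.sqrt (2 * pi * (2 * v)))^-1) *
  (expR (- (x ^+ 2 / (4 * v))) * expR (- (x ^+ 2 / (2 * (2 * v)))))); last by ring.
rewrite -expRD; congr (_ * expR _); last by field; lra.
rewrite (_ : 2 * pi * (2 * v) = 2 * (2 * pi * v)); last by ring.
by rewrite [in RHS]sqrtrM ?ler0n// invfM mulrA divff ?mul1r.
Qed.

Lemma measurable_sin (D : set R) (f : R -> R) :
  measurable_fun D f -> measurable_fun D (sin \o f).
Proof.
apply: measurableT_comp; apply: continuous_measurable_fun.
exact: continuous_sin.
Qed.

Lemma measurable_cos (D : set R) (f : R -> R) :
  measurable_fun D f -> measurable_fun D (cos \o f).
Proof.
apply: measurableT_comp; apply: continuous_measurable_fun.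
exact: continuous_cos.
Qed.

(** Supplies the dominating function for differentiating under the integral, and the decay of the
    boundary terms in the integration by parts. *)
Lemma ler_norm_gauss v x : 0 < v ->
  `|x| * gauss v x <= (1 + v) * Num.sqrt 2 * gauss (2 * v) x.
Proof.
move=> v0; rewrite gauss_double//.
set E := expR _; set g := gauss _ _.
rewrite [leLHS](_ : _ = Num.sqrt 2 * (`|x| * E) * g); last by ring.
rewrite [(1 + v) * _]mulrC ler_wpM2r ?gauss_ge0// ler_wpM2l ?sqrtr_ge0//.
rewrite /E expRN ler_pdivrMr ?expR_gt0// {E g}.
set y := x ^+ 2 / (4 * v).
have y0 : 0 <= y by rewrite divr_ge0 ?sqr_ge0//; lra.
have xy : x ^+ 2 = 4 * v * y by rewrite /y; field; lra.
(* Here x^2 = 4 v y <= (v + y)^2 and v + y <= (1 + v)(1 + y), while 1 + y <= exp y. *)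
apply: (@le_trans _ _ ((1 + v) * (1 + y))); last first.
  by rewrite ler_wpM2l ?expR_ge1Dx//; lra.
rewrite -(@ler_pXn2r _ 2) ?nnegrE ?mulr_ge0//; [|lra..].
rewrite real_normK ?num_real// xy.
have := sqr_ge0 (v - y); have : 0 <= v * y by rewrite mulr_ge0// ltW.
nra.
Qed.

End Gauss.

Section GaussFourier.
Variable R : realType.
Implicit Types v x t : R.
Notation mu := (@lebesgue_measure R).

Lemma integrable_bounded_gauss v (f : R -> R) : 0 < v ->
  measurable_fun setT f -> (forall x, `|f x| <= 1) ->
  mu.-integrable setT (EFin \o (fun x => f x * gauss v x)).
Proof.
move=> v0 mf f1; apply: integrable_dominated (integrable_gauss v0) => //.
  by apply: measurable_funM => //; exact: measurable_gauss.
move=> x _; rewrite normrM [`|gauss _ _|]ger0_norm ?gauss_ge0//.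
by rewrite ler_piMl ?gauss_ge0.
Qed.

Lemma integrable_bounded_id_gauss v (f : R -> R) : 0 < v ->
  measurable_fun setT f -> (forall x, `|f x| <= 1) ->
  mu.-integrable setT (EFin \o (fun x => f x * x * gauss v x)).
Proof.
move=> v0 mf f1.
have v20 : 0 < 2 * v by rewrite mulr_gt0.
apply: (@integrable_dominated _ _ _
  (fun x => (1 + v) * Num.sqrt 2 * gauss (2 * v) x)) => //.
- apply: measurable_funM; first exact: measurable_funM.
  exact: measurable_gauss.
- move=> x _; apply: le_trans (ler_norm_gauss x v0).
  by rewrite 2!normrM [`|gauss _ _|]ger0_norm ?gauss_ge0// ler_wpM2r ?gauss_ge0// ler_piMl.
- have := @integrableZl _ _ _ mu setT measurableT ((1 + v) * Num.sqrt 2) _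
    (integrable_gauss v20).
  by congr (_.-integrable _ _).
Qed.

Lemma is_derive_funM (f g : R -> R) (x df dg : R) :
  is_derive x 1 f df -> is_derive x 1 g dg ->
  is_derive x 1 (fun y => f y * g y) (f x * dg + g x * df).
Proof. by move=> hf hg; exact: is_deriveM. Qed.

Lemma is_derive_linear (c x : R) : is_derive x 1 (fun y => c * y) c.
Proof.
by have := is_derive_funM (is_derive_cst c x 1) (is_derive_id x 1);
  rewrite mulr1 mulr0 addr0.
Qed.

Lemma is_derive_gauss v x : 0 < v ->
  is_derive x (1 : R) (gauss v) (- (x / v * gauss v x)).
Proof.
move=> v0.
have h1 : is_derive x 1 (fun y => - (2 * v)^-1 * (y * y)) (- (x / v)).
  have := is_derive_funM (is_derive_cst (- (2 * v)^-1) x 1)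
    (is_derive_funM (is_derive_id x 1) (is_derive_id x 1)).
  by move/is_derive_eq; apply; rewrite /cst/= /=; field; rewrite gt_eqF.
have h2 := is_derive1_comp (is_derive_expR _) h1.
have := is_derive_funM (is_derive_cst (Num.sqrt (2 * pi * v))^-1 x 1) h2.
have -> : (fun y => cst (Num.sqrt (2 * pi * v))^-1 y *
  (expR \o (fun y => - (2 * v)^-1 * (y * y))) y) = gauss v.
  by apply/funext => y; rewrite /gauss /cst /=; congr (_ * expR _); ring.
move/is_derive_eq; apply; rewrite /gauss /cst /= mulr0 addr0.
rewrite (_ : - (2 * v)^-1 * (x * x) = - (x ^+ 2 / (2 * v))); last by ring.
by rewrite /GRing.scale/=; ring.
Qed.

Lemma sin_le1_norm (y : R) : `|sin y| <= 1.
Proof. by rewrite ler_norml sin_geN1 sin_le1. Qed.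

Lemma cos_le1_norm (y : R) : `|cos y| <= 1.
Proof. by rewrite ler_norml cos_geN1 cos_le1. Qed.

Lemma measurable_sinM t : measurable_fun setT (fun x => sin (t * x)).
Proof. by apply: measurable_sin; exact: measurable_funM. Qed.

Lemma measurable_cosM t : measurable_fun setT (fun x => cos (t * x)).
Proof. by apply: measurable_cos; exact: measurable_funM. Qed.

(** Differentiation under the integral sign. As |sin| <= 1, the function |x| [gauss v x] dominates
    the partial derivative at every parameter, so the interval of radius 1 around t is an arbitrary
    choice. *)
Lemma is_derive_gauss_cos v t : 0 < v ->
  is_derive t 1 (fun t => \int[mu]_x (cos (t * x) * gauss v x))
    (\int[mu]_x (- sin (t * x) * x * gauss v x)).
Proof.
move=> v0.
have dF x (u : R) : is_derive u 1 (fun t : R => cos (t * x) * gauss v x)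
    (- sin (u * x) * x * gauss v x).
  have h := is_derive1_comp (is_derive_cos (x * u)) (is_derive_linear x u).
  have := is_derive_funM h (is_derive_cst (gauss v x) u 1).
  have -> : (fun y => (cos \o *%R x) y * cst (gauss v x) y) =
      (fun t : R => cos (t * x) * gauss v x).
    by apply/funext => y /=; rewrite mulrC [x * y]mulrC mulrC.
  move/is_derive_eq; apply; rewrite mulr0 add0r /cst/= [x * u]mulrC.
  by rewrite /GRing.scale/=; ring.
have ib u := integrable_bounded_gauss v0 (measurable_cosM u)
  (fun x => cos_le1_norm (u * x)).
have pE u x : partial1of2 (fun t x => cos (t * x) * gauss v x) u x =
    - sin (u * x) * x * gauss v x.
  by rewrite partial1of2E; apply: derive_val.
have Ig : mu.-integrable setT (EFin \o (fun x => `|x| * gauss v x)).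
  have := integrable_norm (integrable_bounded_id_gauss (f := cst 1) v0 _ _).
  move=> /(_ (measurable_cst _)) /(_ (fun _ => _)).
  have -> : Num.norm \o (fun x => cst 1 x * x * gauss v x) =
      (fun x => `|x| * gauss v x).
    apply/funext => x /=; rewrite mul1r normrM; congr (_ * _).
    by rewrite ger0_norm ?gauss_ge0.
  by apply => x; rewrite normr1.
have It : `]t - 1, t + 1[%classic t by rewrite /= in_itv/=; apply/andP; split; lra.
have dU u x : `]t - 1, t + 1[%classic u -> [set: R] x ->
  derivable ((fun t x => cos (t * x) * gauss v x)^~ x) u 1 by move=> _ _; exact: ex_derive.
have G0 x : 0 <= `|x| * gauss v x by rewrite mulr_ge0 ?gauss_ge0.
have Gub u x : `]t - 1, t + 1[%classic u -> [set: R] x ->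
    `|partial1of2 (fun t x => cos (t * x) * gauss v x) u x| <= `|x| * gauss v x.
  move=> _ _; rewrite pE 2!normrM normrN [`|gauss _ _|]ger0_norm ?gauss_ge0//.
  by rewrite ler_wpM2r ?gauss_ge0// ler_piMl ?sin_le1_norm.
apply: DeriveDef.
  exact: (derivable_under_integral measurableT It (fun u _ => ib u) dU G0 Ig Gub).
rewrite -derive1E.
rewrite (differentiation_under_integral measurableT It (fun u _ => ib u) dU G0 Ig Gub).
by apply: eq_Rintegral => x _; rewrite pE.
Qed.

(** Reduces an integral over the line to compact intervals, where the fundamental theorem of
    calculus applies. *)
Lemma cvg_Rintegral_expanding (f : R -> R) :
  mu.-integrable setT (EFin \o f) ->
  \int[mu]_(x in `[- n.+1%:R, n.+1%:R]) f x @[n --> \oo] --> \int[mu]_x f x.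
Proof.
move=> intf; have mf : measurable_fun setT f.
  by apply/measurable_EFinP; exact: measurable_int intf.
under eq_fun do rewrite Rintegral_mkcond.
apply: (@Rintegral_dominated_cvg _ _ _ _ (fun x => `|f x|)) => //.
- move=> n; apply/(measurable_restrictT _ _).1 => //.
  exact: measurable_funTS.
- move=> x _; apply: cvg_near_cst; near=> n.
  rewrite patchE mem_set//= in_itv/= -ler_norml.
  apply: (@le_trans _ _ n%:R); last by rewrite ler_nat.
  by near: n; exact: nbhs_infty_ger.
- exact: integrable_norm.
- by move=> n x _; rewrite patchE; case: ifP => //; rewrite normr0.
Unshelve. all: by end_near. Qed.

(** The derivative of sin(t x) [gauss v x] is a combination of the two integrands, and its integral
    over the line vanishes because the boundary values tend to 0. *)
Lemma integral_gauss_by_parts v t : 0 < v ->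
  \int[mu]_x (- sin (t * x) * x * gauss v x) =
  - (v * t) * \int[mu]_x (cos (t * x) * gauss v x).
Proof.
move=> v0.
pose h x := sin (t * x) * gauss v x.
pose h' x := t * (cos (t * x) * gauss v x) + v^-1 * (- sin (t * x) * x * gauss v x).
have dh x : is_derive x 1 h (h' x).
  have := is_derive_funM (is_derive1_comp (is_derive_sin (t * x)) (is_derive_linear t x))
    (is_derive_gauss x v0).
  by move/is_derive_eq; apply; rewrite /h' /GRing.scale/=; ring.
have ch' : continuous h'.
  have cg := continuous_gauss v0.
  have cs : continuous (fun x => sin (t * x)).
    move=> x; apply: (@continuous_comp _ _ _ ( *%R t) sin); last exact: continuous_sin.
    exact: mulrl_continuous.
  have cc : continuous (fun x => cos (t * x)).
    move=> x; apply: (@continuous_comp _ _ _ ( *%R t) cos); last exact: continuous_cos.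
    exact: mulrl_continuous.
  move=> x; apply: cvgD; apply: cvgM; [exact: cvg_cst| |exact: cvg_cst|].
    by apply: cvgM; [exact: cc|exact: cg].
  apply: cvgM; [|exact: cg]; apply: cvgM; [|exact: cvg_id].
  by apply: cvgN; exact: cs.
have ch : continuous h.
  by move=> x; apply/differentiable_continuous/derivable1_diffP; exact: ex_derive.
have i1 : mu.-integrable setT (EFin \o (fun x => cos (t * x) * gauss v x)).
  by apply: integrable_bounded_gauss => // [|x]; [exact: measurable_cosM|exact: cos_le1_norm].
have i2 : mu.-integrable setT (EFin \o (fun x => - sin (t * x) * x * gauss v x)).
  apply: integrable_bounded_id_gauss => // [|x].
    by apply: measurableT_comp => //; exact: measurable_sinM.
  by rewrite normrN sin_le1_norm.
have i1' : mu.-integrable setT (EFin \o (fun x => t * (cos (t * x) * gauss v x))).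
  exact: (@integrableZl _ _ _ mu setT measurableT t _ i1).
have i2' : mu.-integrable setT (EFin \o (fun x => v^-1 * (- sin (t * x) * x * gauss v x))).
  exact: (@integrableZl _ _ _ mu setT measurableT v^-1 _ i2).
have ih' : mu.-integrable setT (EFin \o h').
  exact: (@integrableD _ _ _ mu setT measurableT _ _ i1' i2').
have F n : \int[mu]_(x in `[- n.+1%:R, n.+1%:R]) h' x = h n.+1%:R - h (- n.+1%:R).
  rewrite /Rintegral (@continuous_FTC2 _ h' h)//.
  - by apply: gtrN; rewrite ltr0Sn.
  - exact: continuous_subspaceT.
  - split; first by move=> x _; exact: ex_derive.
    + by apply: cvg_at_right_filter; exact: ch.
    + by apply: cvg_at_left_filter; exact: ch.
  - by move=> x _; rewrite derive1E; exact: derive_val.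
have h0 : \int[mu]_x h' x = 0.
  apply: (cvg_unique _ (cvg_Rintegral_expanding ih')) => //=.
  under eq_fun do rewrite F.
  (* [ler_norm_gauss] with the exponential in [gauss (2 * v)] bounded by 1 gives the decay C / x,
     which is enough for a harmonic squeeze. *)
  pose C := (1 + v) * Num.sqrt 2 * (Num.sqrt (2 * pi * (2 * v)))^-1.
  have hC x : 0 < x -> `|h x| <= C / x /\ `|h (- x)| <= C / x.
    move=> x0.
    have gC : gauss v x <= C / x.
      rewrite ler_pdivlMr// mulrC -[X in X * _](gtr0_norm x0).
      apply: le_trans (ler_norm_gauss x v0) _.
      rewrite /C ler_wpM2l ?mulr_ge0 ?sqrtr_ge0//; first lra.
      rewrite /gauss ler_piMr ?invr_ge0 ?sqrtr_ge0// -[leRHS]expR0 ler_expR.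
      by rewrite oppr_le0 divr_ge0 ?sqr_ge0// !mulr_ge0// ltW.
    by split; apply: le_trans gC; rewrite /h normrM ?gaussN
      [`|gauss _ _|]ger0_norm ?gauss_ge0// ler_piMl ?gauss_ge0 ?sin_le1_norm.
  apply: (@squeeze_cvgr _ _ _ _ (fun n => - (2 * C * n.+1%:R^-1)) (fun n => 2 * C * n.+1%:R^-1)).
  - near=> n; have [a b] := hC n.+1%:R (ltr0Sn _ _).
    rewrite -ler_norml (le_trans (ler_normB _ _))// (le_trans (lerD a b))//.
    by rewrite le_eqVlt; apply/orP; left; apply/eqP; ring.
  - rewrite -oppr0 -(mulr0 (2 * C)); apply: cvgN; apply: cvgM; first exact: cvg_cst.
    exact: cvg_harmonic.
  - rewrite -(mulr0 (2 * C)); apply: cvgM; first exact: cvg_cst.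
    exact: cvg_harmonic.
move: h0; rewrite RintegralD// !RintegralZl// => h0.
set I := \int[mu]_x (- sin (t * x) * x * gauss v x) in h0 *.
rewrite (_ : I = v * (v^-1 * I)); last by rewrite mulrA divff ?mul1r ?gt_eqF.
by move/eqP: h0; rewrite addrC addr_eq0 => /eqP ->; ring.
Unshelve. all: by end_near. Qed.

(** By the two previous results the transform F solves F' = - v t F. Hence F(t) exp(v t^2 / 2) has
    derivative 0, and its value at 0 is the total mass 1. *)
Lemma gauss_fourier v t : 0 < v ->
  \int[mu]_x (cos (t * x) * gauss v x) = expR (- (v * t ^+ 2 / 2)).
Proof.
move=> v0.
pose F t := \int[mu]_x (cos (t * x) * gauss v x).
pose E (t : R) := expR (v / 2 * (t * t)).
have dE (s : R) : is_derive s 1 E (v * s * E s).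
  have h := is_derive_funM (is_derive_cst (v / 2) s 1)
    (is_derive_funM (is_derive_id s 1) (is_derive_id s 1)).
  have := is_derive1_comp (is_derive_expR _) h.
  by move/is_derive_eq; apply; rewrite /E /cst /GRing.scale/=; field.
have dFE (s : R) : is_derive s 1 (fun s => F s * E s) 0.
  have := is_derive_funM (is_derive_gauss_cos s v0) (dE s).
  rewrite integral_gauss_by_parts//.
  by move/is_derive_eq; apply; rewrite /F; ring.
have := is_derive_0_is_cst t 0 dFE.
rewrite {2}/F; under eq_Rintegral do rewrite mul0r cos0 mul1r.
rewrite integral_gauss// mul1r {2}/E !mulr0 expR0 /E -/(F t).
rewrite (_ : v / 2 * (t * t) = v * t ^+ 2 / 2); last by ring.
move=> h; have E0 := lt0r_neq0 (expR_gt0 (v * t ^+ 2 / 2)).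
by apply: (mulIf E0); rewrite expRN mulVf.
Qed.

End GaussFourier.

(** * From characteristic functions to interval frequencies *)

Definition mean (R : realType) (s : seq R) (f : R -> R) : R :=
  (\sum_(x <- s) f x) / (size s)%:R.

Section Mean.
Variable R : realType.
Implicit Types (s : seq R) (f g : R -> R).
Notation mu := (@lebesgue_measure R).

Lemma eq_mean s f g : f =1 g -> mean s f = mean s g.
Proof. by move=> fg; rewrite /mean; under eq_bigr do rewrite fg. Qed.

Lemma meanD s f g : mean s (fun x => f x + g x) = mean s f + mean s g.
Proof. by rewrite /mean big_split mulrDl. Qed.

Lemma meanZ s c f : mean s (fun x => c * f x) = c * mean s f.
Proof. by rewrite /mean -mulr_sumr mulrA. Qed.

Lemma ler_mean s f g : (forall x, f x <= g x) -> mean s f <= mean s g.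
Proof. by move=> fg; rewrite /mean ler_wpM2r ?invr_ge0// ler_sum. Qed.

(** Only an inequality, because the mean over the empty sequence is 0. *)
Lemma mean_cst_le s c : 0 <= c -> mean s (fun=> c) <= c.
Proof.
move=> c0; rewrite /mean big_const_seq count_predT iter_addr addr0.
case: s => [|x s]; first by rewrite mul0r.
by rewrite -[c *+ _]mulr_natr mulfK // pnatr_eq0.
Qed.

Lemma ler_norm_mean s f c : (forall x, `|f x| <= c) -> `|mean s f| <= c.
Proof.
move=> fc; have c0 : 0 <= c by exact: le_trans (fc 0).
apply: le_trans (mean_cst_le s c0); rewrite /mean normrM.
rewrite [`|_^-1|]ger0_norm ?invr_ge0// ler_wpM2r ?invr_ge0//.
by apply: le_trans (ler_norm_sum _ _ _) _; exact: ler_sum.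
Qed.

Lemma mean_integral s (D : set R) (f : R -> R -> R) : measurable D ->
  (forall x, mu.-integrable D (EFin \o f x)) ->
  \int[mu]_(t in D) mean s (f^~ t) = mean s (fun x => \int[mu]_(t in D) f x t).
Proof.
move=> mD intf; pose S s t := \sum_(x <- s) f x t.
have SE x s' : S (x :: s') = (fun t => f x t + S s' t).
  by apply/funext => t; rewrite /S big_cons.
have intS s' : mu.-integrable D (EFin \o S s').
  elim: s' => [|x s' IH].
    rewrite (_ : _ \o _ = cst 0%E); first exact: integrable0.
    by apply/funext => t; rewrite /= /S big_nil.
  rewrite SE; exact: (@integrableD _ _ _ mu D mD _ _ (intf x) IH).
transitivity (\int[mu]_(t in D) (S s t * (size s)%:R^-1)); first by [].
rewrite RintegralZr// /mean; congr (_ / _).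
elim: s => [|x s IH].
  rewrite big_nil -[RHS](mul0r (fine (mu D))) -Rintegral_cst//.
  by apply: eq_Rintegral => t _; rewrite /S big_nil.
by rewrite SE RintegralD// IH big_cons.
Qed.

Lemma measurable_mean s (D : set R) (f : R -> R -> R) :
  (forall x, measurable_fun D (f x)) ->
  measurable_fun D (fun t => mean s (f^~ t)).
Proof.
move=> mf; rewrite /mean; apply: measurable_funM => //.
exact: measurable_sum.
Qed.

End Mean.

Section GaussBounds.
Variable R : realType.
Implicit Types a b c d v x y : R.
Notation mu := (@lebesgue_measure R).

(** [gauss v] and [gauss v^-1] are Fourier dual; this is the relation between their normalising
    constants. *)
Lemma sqrt_2piV v : 0 < v -> Num.sqrt (2 * pi * v) * Num.sqrt (2 * pi * v^-1) = 2 * pi.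
Proof.
move=> v0; have p0 : 0 < 2 * (pi : R) by rewrite mulr_gt0 ?pi_gt0.
rewrite -sqrtrM; last by rewrite mulr_ge0// ltW.
have -> : 2 * pi * v * (2 * pi * v^-1) = (2 * pi) ^+ 2.
  by field; rewrite gt_eqF.
by rewrite sqrtr_sqr gtr0_norm.
Qed.

(** Precisions add under multiplication: the first factor has precision 1 and [gauss v^-1] has
    precision v. *)
Lemma gauss_mulV v (t : R) : 0 < v -> expR (- (t ^+ 2 / 2)) * gauss v^-1 t =
  Num.sqrt (2 * pi * (1 + v)^-1) / Num.sqrt (2 * pi * v^-1) * gauss (1 + v)^-1 t.
Proof.
move=> v0; rewrite /gauss.
have h w : 0 < w -> Num.sqrt (2 * pi * w) != 0 :> R.
  by move=> w0; rewrite gt_eqF// sqrtr_gt0 !mulr_gt0 ?pi_gt0.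
have h1 := h v^-1; have h2 := h (1 + v)^-1; rewrite !invr_gt0 in h1 h2.
have h3 : 0 < 1 + v by lra.
rewrite (_ : _ / _ * _ = (Num.sqrt (2 * pi * v^-1))^-1 *
  expR (- (t ^+ 2 / (2 * (1 + v)^-1)))); last first.
  by field; rewrite h1// h2.
rewrite mulrCA -expRD; congr (_ * expR _).
by field; rewrite !gt_eqF.
Qed.

Lemma gauss_le1 v x : 1 <= v -> gauss v x <= 1.
Proof.
move=> v1; have pi2 := pi_ge2 R; rewrite /gauss.
rewrite mulr_ile1 ?invr_ge0 ?sqrtr_ge0 ?expR_ge0//; last first.
  by rewrite -[leRHS]expR0 ler_expR oppr_le0 divr_ge0 ?sqr_ge0//; lra.
rewrite invf_le1; last by rewrite sqrtr_gt0; nra.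
by rewrite -[leLHS]sqrtr1 ler_sqrt; nra.
Qed.

Lemma integrable_gauss_shift_on v (D : set R) x : measurable D -> 0 < v ->
  mu.-integrable D (EFin \o (fun y => gauss v (y - x))).
Proof.
move=> mD v0; apply: integrableS (integrable_gauss_shift x v0) => //.
Qed.

Lemma le_Rintegral_subset (D E : set R) (f : R -> R) : measurable D ->
  measurable E -> D `<=` E -> mu.-integrable E (EFin \o f) ->
  (forall x, 0 <= f x) -> \int[mu]_(x in D) f x <= \int[mu]_(x in E) f x.
Proof.
move=> mD mE DE intf f0; apply: fine_le.
- by apply: integrable_fin_num => //; apply: integrableS intf.
- exact: integrable_fin_num.
- apply: ge0_subset_integral => //; first exact: measurable_int intf.
  by move=> x _; rewrite lee_fin.
Qed.

Lemma integral_gauss_shift_le1 v (D : set R) x : measurable D -> 0 < v ->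
  \int[mu]_(y in D) gauss v (y - x) <= 1.
Proof.
move=> mD v0; rewrite -(integral_gauss_shift x v0).
apply: le_Rintegral_subset => //; first exact: integrable_gauss_shift.
by move=> y; exact: gauss_ge0.
Qed.

(** At distance at least r from x, the factor split off by [gauss_double] is at most exp(- r^2 / (4
    v)); the remaining Gaussian has mass at most 1. *)
Lemma gauss_tail v (r : R) (D : set R) x : measurable D -> 0 < v ->
  0 <= r -> (forall y, D y -> r <= `|y - x|) ->
  \int[mu]_(y in D) gauss v (y - x) <= Num.sqrt 2 * expR (- (r ^+ 2 / (4 * v))).
Proof.
move=> mD v0 r0 Dr; set C := _ * _.
have v20 : 0 < 2 * v by lra.
have C0 : 0 <= C by rewrite mulr_ge0 ?sqrtr_ge0 ?expR_ge0.
apply: (@le_trans _ _ (C * \int[mu]_(y in D) gauss (2 * v) (y - x))); last first.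
  by rewrite ler_piMr// integral_gauss_shift_le1.
rewrite -RintegralZl//; last exact: integrable_gauss_shift_on.
apply: le_Rintegral => //; first exact: integrable_gauss_shift_on.
  have := integrable_gauss_shift_on x mD v20.
  exact: (@integrableZl _ _ _ mu D mD C).
move=> y Dy; rewrite gauss_double// ler_wpM2r ?gauss_ge0//.
rewrite ler_wpM2l ?sqrtr_ge0// ler_expR lerN2 ler_wpM2r ?invr_ge0//; first lra.
by rewrite -[leRHS]real_normK ?num_real// lerXn2r ?nnegrE// Dr.
Qed.

End GaussBounds.

(** * Convergence of the smoothed averages *)

Section Levy.
Variables (R : realType) (s : nat -> seq R).
Notation mu := (@lebesgue_measure R).
Hypothesis cos_cvg : forall t : R,
  mean (s n) (fun x => cos (t * x)) @[n --> \oo] --> expR (- (t ^+ 2 / 2)).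
Hypothesis sin_cvg : forall t : R,
  mean (s n) (fun x => sin (t * x)) @[n --> \oo] --> (0 : R).

(* Fourier inversion is avoided: the Gaussian kernel is itself a Fourier
   integral, so its average over [s n] is an integral of the empirical
   characteristic functions. *)
Lemma mean_gauss_cvg v (y : R) : 0 < v ->
  mean (s n) (fun x => gauss v (y - x)) @[n --> \oo] --> gauss (1 + v) y.
Proof.
move=> v0; have vi0 : 0 < v^-1 by rewrite invr_gt0.
have v1 : 0 < 1 + v by lra.
have v1i : 0 < (1 + v)^-1 by rewrite invr_gt0.
pose P := (Num.sqrt (2 * pi * v))^-1.
have mc (x : R) : measurable_fun setT (fun t => cos ((y - x) * t) * gauss v^-1 t).
  by apply: measurable_funM; [exact: measurable_cosM|exact: measurable_gauss].
have ic (x : R) : mu.-integrable setT (EFin \o (fun t => cos ((y - x) * t) * gauss v^-1 t)).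
  by apply: integrable_bounded_gauss => // [|t]; [exact: measurable_cosM|exact: cos_le1_norm].
have E n : mean (s n) (fun x => gauss v (y - x)) =
    P * \int[mu]_t mean (s n) (fun x => cos ((y - x) * t) * gauss v^-1 t).
  rewrite (@mean_integral _ (s n) setT (fun x t => cos ((y - x) * t) * gauss v^-1 t))// -meanZ.
  apply: eq_mean => x; rewrite gauss_fourier// /gauss; congr (_ * expR (- _)).
  by field; rewrite gt_eqF.
(* The limit has the same Fourier representation, with exp(- t^2 / 2) in place of the empirical
   characteristic function, so only the integrands have to be compared. *)
have L : gauss (1 + v) y =
    P * \int[mu]_t (cos (y * t) * (expR (- (t ^+ 2 / 2)) * gauss v^-1 t)).
  pose K := Num.sqrt (2 * pi * (1 + v)^-1) / Num.sqrt (2 * pi * v^-1).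
  rewrite (@eq_Rintegral _ _ _ mu setT
    (fun t => K * (cos (y * t) * gauss (1 + v)^-1 t))); last first.
    by move=> t _; rewrite gauss_mulV// -/K mulrCA.
  rewrite RintegralZl//; last first.
    by apply: integrable_bounded_gauss => // [|t]; [exact: measurable_cosM|exact: cos_le1_norm].
  rewrite gauss_fourier// mulrA /gauss; congr (_ * expR (- _)); last first.
    by field; rewrite gt_eqF.
  have p0 : 0 < 2 * (pi : R) by rewrite mulr_gt0 ?pi_gt0.
  have h w : 0 < w -> Num.sqrt (2 * pi * w) != 0 :> R.
    by move=> w0; rewrite gt_eqF// sqrtr_gt0 !mulr_gt0 ?pi_gt0.
  have := sqrt_2piV v0; have := sqrt_2piV v1.
  rewrite /P /K; have := h _ v0; have := h _ vi0; have := h _ v1; have := h _ v1i.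
  set A := Num.sqrt (2 * pi * (1 + v)); set A' := Num.sqrt _.
  set B := Num.sqrt (2 * pi * v); set B' := Num.sqrt _.
  move=> A'0 A0 B'0 B0 AA BB.
  rewrite mulrCA -invfM BB -AA invfM mulrCA mulfV// mulr1 //.
rewrite L; under eq_fun do rewrite E.
apply: cvgM; first exact: cvg_cst.
apply: (@Rintegral_dominated_cvg _ _ _ _ (gauss v^-1)) => //.
- by move=> n; apply: (@measurable_mean _ _ _ (fun x t => cos ((y - x) * t) * gauss v^-1 t)).
- move=> t _.
  have -> : (fun n => mean (s n) (fun x => cos ((y - x) * t) * gauss v^-1 t)) =
     (fun n => (cos (y * t) * mean (s n) (fun x => cos (t * x)) +
                sin (y * t) * mean (s n) (fun x => sin (t * x))) * gauss v^-1 t).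
    apply/funext => n; rewrite -!meanZ -meanD mulrC -meanZ; apply: eq_mean => x.
    by rewrite mulrBl cosB [x * t]mulrC; ring.
  rewrite mulrA; apply: cvgM; last exact: cvg_cst.
  rewrite -[X in _ --> X]addr0 -[X in _ + X](mulr0 (sin (y * t))).
  by apply: cvgD; apply: cvgM; try exact: cvg_cst.
- exact: integrable_gauss.
- move=> n t _; apply: ler_norm_mean => x.
  by rewrite normrM [`|gauss _ _|]ger0_norm ?gauss_ge0// ler_piMl ?gauss_ge0 ?cos_le1_norm.
Qed.

(** The function averaged here is the smoothed indicator of [c, d]. The pointwise limits integrate
    because the peak value of the kernel bounds all the means. *)
Lemma mean_gauss_itv_cvg v (c d : R) : 0 < v ->
  mean (s n) (fun x => \int[mu]_(y in `[c, d]) gauss v (y - x)) @[n --> \oo] -->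
  \int[mu]_(y in `[c, d]) gauss (1 + v) y.
Proof.
move=> v0; have mcd : measurable `[c, d]%classic by exact: measurable_itv.
have E n : mean (s n) (fun x => \int[mu]_(y in `[c, d]) gauss v (y - x)) =
   \int[mu]_(y in `[c, d]) mean (s n) (fun x => gauss v (y - x)).
  rewrite (@mean_integral _ (s n) `[c, d]%classic (fun x y => gauss v (y - x)))//.
  by move=> x; exact: integrable_gauss_shift_on.
under eq_fun do rewrite E.
apply: (@Rintegral_dominated_cvg _ _ _ _ (fun=> (Num.sqrt (2 * pi * v))^-1)) => //.
- move=> n; apply: (@measurable_mean _ _ _ (fun x y => gauss v (y - x))) => x.
  apply/measurable_EFinP.
  by have /measurable_int := integrable_gauss_shift_on x mcd v0.
- by move=> y _; exact: mean_gauss_cvg.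
- apply: measurable_bounded_integrable => //.
    by rewrite /= lebesgue_measure_itv; case: ifP => // _; rewrite ltry.
  apply: bounded_cst.
- move=> n y _; apply: ler_norm_mean => x.
  rewrite ger0_norm ?gauss_ge0// /gauss ler_piMr ?invr_ge0 ?sqrtr_ge0//.
  by rewrite -[leRHS]expR0 ler_expR oppr_le0 divr_ge0 ?sqr_ge0// mulr_ge0// ltW.
Qed.

End Levy.

(** * Comparison of interval indicators with their smoothings *)

Section Sandwich.
Variable R : realType.
Implicit Types a b c d v x y r : R.
Notation mu := (@lebesgue_measure R).

Lemma Rintegral_cover (D A B : set R) (f : R -> R) : measurable D ->
  measurable A -> measurable B -> D `<=` A `|` B ->
  mu.-integrable setT (EFin \o f) -> (forall x, 0 <= f x) ->
  \int[mu]_(x in D) f x <= \int[mu]_(x in A) f x + \int[mu]_(x in B) f x.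
Proof.
move=> mD mA mB DAB intf f0.
have mBA : measurable (B `\` A) by exact: measurableD.
have iS E : measurable E -> mu.-integrable E (EFin \o f).
  by move=> mE; apply: integrableS intf.
apply: (@le_trans _ _ (\int[mu]_(x in A `|` (B `\` A)) f x)).
  apply: le_Rintegral_subset => //; [exact: measurableU|by rewrite setUDr setDv setD0|].
  by apply: iS; exact: measurableU.
rewrite Rintegral_setU//; last 2 first.
- by apply: iS; exact: measurableU.
- by apply/disj_setPS => x /= [Ax [_ nAx]].
rewrite lerD2l; by apply: le_Rintegral_subset => //; exact: iS.
Qed.

Lemma Rintegral_itv_le (f : R -> R) c d : c <= d ->
  mu.-integrable setT (EFin \o f) -> (forall x, f x <= 1) ->
  \int[mu]_(x in `[c, d]) f x <= d - c.
Proof.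
move=> cd intf f1.
have mcd : measurable `[c, d]%classic by exact: measurable_itv.
have mucd : mu `[c, d]%classic = (d - c)%:E.
  rewrite /= lebesgue_measure_itv/= lte_fin.
  by case: ltgtP cd => // -> _; rewrite subrr.
apply: (@le_trans _ _ (\int[mu]_(x in `[c, d]) (fun=> 1) x)).
  apply: le_Rintegral => //; first by apply: integrableS intf.
  apply: measurable_bounded_integrable => //; last exact: bounded_cst.
  by have -> : (mu `[c, d]%classic < +oo)%E by rewrite mucd ltry.
by rewrite Rintegral_cst// -[X in fine X]/(mu `[c, d]%classic) mucd mul1r.
Qed.

(** If x lies in [a, b], the kernel centred at x has all its mass in the interval widened by r, up
    to a tail. *)
Lemma indic_le_smoothed v r a b x : 0 < v -> 0 <= r ->
  ((x \in `[a, b]) : nat)%:R <= \int[mu]_(y in `[a - r, b + r]) gauss v (y - x) +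
    Num.sqrt 2 * expR (- (r ^+ 2 / (4 * v))).
Proof.
move=> v0 r0; set D := `[a - r, b + r]%classic.
have mD : measurable D by exact: measurable_itv.
have [xab|_] := boolP (x \in `[a, b]); last first.
  rewrite addr_ge0 ?mulr_ge0 ?sqrtr_ge0 ?expR_ge0//.
  by apply: Rintegral_ge0 => y _; exact: gauss_ge0.
rewrite -[leLHS](integral_gauss_shift x v0).
have mC : measurable (~` D) by exact: measurableC.
apply: (@le_trans _ _ (\int[mu]_(y in D) gauss v (y - x) +
    \int[mu]_(y in ~` D) gauss v (y - x))).
  apply: Rintegral_cover => //; [by rewrite setUv|exact: integrable_gauss_shift|].
  by move=> y; exact: gauss_ge0.
rewrite lerD2l; apply: gauss_tail => // y; rewrite /D/= in_itv/= => /negP.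
move: xab; rewrite in_itv/= => /andP[ax xb].
rewrite negb_and -!ltNge ler_normr => /orP[|] h; apply/orP; [right|left]; lra.
Qed.

(** If x lies outside [a, b], every point of the interval shrunk by r is at distance at least r from
    x, so only a tail is integrated. *)
Lemma smoothed_le_indic v r a b x : 0 < v -> 0 <= r ->
  \int[mu]_(y in `[a + r, b - r]) gauss v (y - x) <=
  ((x \in `[a, b]) : nat)%:R + Num.sqrt 2 * expR (- (r ^+ 2 / (4 * v))).
Proof.
move=> v0 r0.
have mD : measurable `[a + r, b - r]%classic by exact: measurable_itv.
have [xab|xab] := boolP (x \in `[a, b]).
  apply: (le_trans (integral_gauss_shift_le1 x mD v0)).
  by rewrite lerDl mulr_ge0 ?sqrtr_ge0 ?expR_ge0.
rewrite add0r; apply: gauss_tail => // y; rewrite /= in_itv/= => /andP[ay yb].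
move: xab; rewrite in_itv/= negb_and -!ltNge ler_normr.
by move=> /orP[|] h; apply/orP; [left|right]; lra.
Qed.

(** The two strips of width r cost at most r each, as the density is at most 1. On [a, b] the ratio
    of the densities is at most exp(y^2 v / 2), and |y| <= |a| + |b|. *)
Lemma gauss_itv_upper v r a b : 0 < v -> 0 <= r ->
  \int[mu]_(y in `[a - r, b + r]) gauss (1 + v) y <=
  expR ((`|a| + `|b|) ^+ 2 * v / 2) * \int[mu]_(y in `[a, b]) gauss 1 y + 2 * r.
Proof.
move=> v0 r0; have v1 : 0 < 1 + v by lra.
have ig := integrable_gauss v1.
have g0 y := gauss_ge0 (1 + v) y.
have g1 (y : R) : gauss (1 + v) y <= 1 by apply: gauss_le1; lra.
have mI (c d : R) : measurable `[c, d]%classic by exact: measurable_itv.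
apply: (@le_trans _ _ (\int[mu]_(y in `[a - r, a] `|` `[a, b]) gauss (1 + v) y +
    \int[mu]_(y in `[b, b + r]) gauss (1 + v) y)).
  apply: Rintegral_cover => //; first exact: measurableU.
  move=> y /=; rewrite !in_itv/= => /andP[h1 h2].
  have [ya|ay] := leP y a; first by left; left; apply/andP; split; lra.
  have [yb|by_] := leP y b; first by left; right; apply/andP; split; lra.
  by right; apply/andP; split; lra.
apply: (@le_trans _ _ (\int[mu]_(y in `[a - r, a]) gauss (1 + v) y +
    \int[mu]_(y in `[a, b]) gauss (1 + v) y + \int[mu]_(y in `[b, b + r]) gauss (1 + v) y)).
  by rewrite lerD2r; apply: Rintegral_cover => //; exact: measurableU.
have h1 : \int[mu]_(y in `[a - r, a]) gauss (1 + v) y <= a - (a - r).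
  by apply: Rintegral_itv_le => //; lra.
have h2 : \int[mu]_(y in `[b, b + r]) gauss (1 + v) y <= b + r - b.
  by apply: Rintegral_itv_le => //; lra.
set C := expR _.
suff : \int[mu]_(y in `[a, b]) gauss (1 + v) y <= C * \int[mu]_(y in `[a, b]) gauss 1 y.
  by lra.
have ig1 : mu.-integrable `[a, b] (EFin \o gauss 1).
  exact: integrableS (integrable_gauss ltr01).
rewrite -RintegralZl//; apply: le_Rintegral => //.
- exact: integrableS ig.
- exact: (@integrableZl _ _ _ mu `[a, b]%classic (mI a b) C _ ig1).
move=> y; rewrite /= in_itv/= => /andP[ay yb].
rewrite /gauss !mulr1 mulrCA; apply: ler_pM; rewrite ?invr_ge0 ?sqrtr_ge0 ?expR_ge0//.
  have pi0 := pi_gt0 R.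
  rewrite lef_pV2 ?posrE ?sqrtr_gt0 ?mulr_gt0//.
  by rewrite ler_sqrt; nra.
rewrite /C -expRD ler_expR.
have yM : y ^+ 2 <= (`|a| + `|b|) ^+ 2.
  rewrite -[leLHS]real_normK ?num_real// lerXn2r ?nnegrE ?addr_ge0//.
  have := ler_norm b; have := ler_norm (- a); rewrite normrN.
  rewrite ler_norml => ? ?; have := normr_ge0 a; have := normr_ge0 b.
  by move=> ? ?; apply/andP; split; lra.
have -> : - (y ^+ 2 / (2 * (1 + v))) = y ^+ 2 * (v / (1 + v)) / 2 - y ^+ 2 / 2.
  by field; rewrite gt_eqF.
rewrite lerD2r ler_wpM2r ?invr_ge0//; apply: ler_pM => //.
- exact: sqr_ge0.
- by rewrite divr_ge0// ltW.
- by rewrite ler_pdivrMr//; nra.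
Qed.

(** Pointwise [gauss 1] is at most (1 + v) times [gauss (1 + v)]: the exact ratio of the constants
    is sqrt(1 + v), bounded here by 1 + v. The strips again cost r each. *)
Lemma gauss_itv_lower v r a b : 0 < v -> 0 <= r ->
  \int[mu]_(y in `[a, b]) gauss 1 y / (1 + v) <=
  \int[mu]_(y in `[a + r, b - r]) gauss (1 + v) y + 2 * r.
Proof.
move=> v0 r0; have v1 : 0 < 1 + v by lra.
have ig := integrable_gauss v1.
have g0 y := gauss_ge0 (1 + v) y.
have g1 (y : R) : gauss (1 + v) y <= 1 by apply: gauss_le1; lra.
have mI (c d : R) : measurable `[c, d]%classic by exact: measurable_itv.
apply: (@le_trans _ _ (\int[mu]_(y in `[a, b]) gauss (1 + v) y)); last first.
  apply: (@le_trans _ _ (\int[mu]_(y in `[a, a + r] `|` `[a + r, b - r]) gauss (1 + v) y +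
      \int[mu]_(y in `[b - r, b]) gauss (1 + v) y)).
    apply: Rintegral_cover => //; first exact: measurableU.
    move=> y /=; rewrite !in_itv/= => /andP[h1 h2].
    have [ya|ay] := leP y (a + r); first by left; left; apply/andP; split; lra.
    have [yb|by_] := leP y (b - r); first by left; right; apply/andP; split; lra.
    by right; apply/andP; split; lra.
  apply: (@le_trans _ _ (\int[mu]_(y in `[a, a + r]) gauss (1 + v) y +
      \int[mu]_(y in `[a + r, b - r]) gauss (1 + v) y +
      \int[mu]_(y in `[b - r, b]) gauss (1 + v) y)).
    by rewrite lerD2r; apply: Rintegral_cover => //; exact: measurableU.
  have h1 : \int[mu]_(y in `[a, a + r]) gauss (1 + v) y <= a + r - a.
    by apply: Rintegral_itv_le => //; lra.
  have h2 : \int[mu]_(y in `[b - r, b]) gauss (1 + v) y <= b - (b - r).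
    by apply: Rintegral_itv_le => //; lra.
  by lra.
have ig1 : mu.-integrable `[a, b] (EFin \o gauss 1).
  exact: integrableS (integrable_gauss ltr01).
rewrite mulrC -RintegralZl//; apply: le_Rintegral => //.
- exact: (@integrableZl _ _ _ mu `[a, b]%classic (mI a b) (1 + v)^-1 _ ig1).
- exact: integrableS ig.
move=> y _; rewrite /gauss !mulr1 mulrA.
have pi0 := pi_gt0 R.
apply: ler_pM; rewrite ?mulr_ge0 ?invr_ge0 ?sqrtr_ge0 ?expR_ge0//; first exact: ltW.
  rewrite -invfM lef_pV2 ?posrE ?mulr_gt0 ?sqrtr_gt0 ?mulr_gt0//.
  have -> : Num.sqrt (2 * pi * (1 + v)) = Num.sqrt (1 + v) * Num.sqrt (2 * pi).
    by rewrite mulrC sqrtrM// ltW.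
  apply: ler_wpM2r; first exact: sqrtr_ge0.
  rewrite -[leRHS](gtr0_norm v1) -sqrtr_sqr ler_sqrt ?exprn_ge0 ?ltW//.
  by rewrite expr2; nra.
rewrite ler_expR lerN2 ler_wpM2l ?sqr_ge0// lef_pV2 ?posrE; lra.
Qed.

End Sandwich.

(** The width r is fixed before v, so letting v tend to 0 makes the tail small. *)
Lemma near_small_variance (R : realType) (M e r : R) : 0 <= M -> 0 < e -> 0 < r ->
  \forall v \near (0 : R)^'+, [/\ 0 < v, v < e,
    Num.sqrt 2 * expR (- (r ^+ 2 / (4 * v))) <= e & expR (M * v / 2) <= 1 + e].
Proof.
move=> M0 e0 r0; near=> v.
have v0 : 0 < v by near: v; exact: nbhs_right_gt.
have ve : v < e by near: v; apply: nbhs_right_lt.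
(* M may be 0, hence the denominator [M + 1]. *)
have vM : v < (M + 1)^-1 by near: v; apply: nbhs_right_lt; rewrite invr_gt0; lra.
have veM : v < e / (M + 1).
  by near: v; apply: nbhs_right_lt; rewrite !divr_gt0//; lra.
have vr : v < e * r ^+ 2 / 8.
  (* From sqrt 2 <= 2 and exp(- r^2 / (4 v)) <= 4 v / r^2 the tail is at most 8 v / r^2, whence the
     8. *)
  by near: v; apply: nbhs_right_lt; rewrite divr_gt0// mulr_gt0// exprn_gt0.
split => //.
  have s2 : Num.sqrt 2 <= 2 :> R.
    rewrite -[leRHS]ger0_norm// -sqrtr_sqr ler_sqrt ?exprn_ge0//.
    by rewrite expr2; lra.
  apply: (@le_trans _ _ (2 * (4 * v / r ^+ 2))).
    apply: ler_pM => //; rewrite ?sqrtr_ge0 ?expR_ge0//.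
    rewrite expRN -[leRHS]invf_div lef_pV2 ?posrE ?expR_gt0 ?divr_gt0 ?exprn_gt0 ?mulr_gt0//.
    by apply: le_trans (expR_ge1Dx _); rewrite lerDr.
  rewrite mulrA ler_pdivrMr ?exprn_gt0//.
  rewrite [e * _](_ : _ = 2 * 4 * (e * r ^+ 2 / 8)); last by field.
  by rewrite mulrA ler_pM2l// ltW.
set z := M * v / 2.
have Mv1 : M * v < 1.
  have : (M + 1) * v < 1 by rewrite -ltr_pdivlMl ?mulr1//; lra.
  by nra.
have Mve : M * v <= e.
  have : v * (M + 1) < e by rewrite -ltr_pdivlMr//; lra.
  by nra.
have z0 : 0 <= z by rewrite /z divr_ge0// mulr_ge0// ltW.
have zle : z < 1 / 2 by rewrite /z; lra.
(* For 0 <= z < 1/2 one has exp z <= 1 / (1 - z) <= 1 + 2 z, and 2 z = M v <= e. *)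
apply: (@le_trans _ _ (1 - z)^-1).
  rewrite -[leLHS]invrK -expRN lef_pV2 ?posrE ?expR_gt0//; last by lra.
  exact: expR_ge1Dx.
apply: (@le_trans _ _ (1 + 2 * z)); last by rewrite /z; lra.
by rewrite -[leLHS]mul1r ler_pdivrMr; nra.
Unshelve. all: by end_near. Qed.

(** L is the Gaussian integral and m the frequency; [Hu], [Hl] are the smoothed means on the wider
    and the narrower interval, [Iu], [Il] their limits. Each direction loses 5 e, and 16 leaves
    room. *)
Lemma sandwich_le (R : realType) (e v C t L m Iu Il Hu Hl : R) :
  0 < e -> 0 < v -> v < e -> 0 <= L -> L <= 1 -> t <= e -> C <= 1 + e ->
  Iu <= C * L + 2 * e -> L / (1 + v) <= Il + 2 * e ->
  `|Iu - Hu| <= e -> `|Il - Hl| <= e -> m <= Hu + t -> Hl <= m + t ->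
  `|L - m| <= 16 * e.
Proof.
move=> e0 v0 ve L0 L1 te Ce U Lw nu nl mu_ ml_.
have U' : C * L <= L + e.
  apply: (@le_trans _ _ ((1 + e) * L)); first by rewrite ler_wpM2r.
  by nra.
have L' : L - e <= L / (1 + v) by rewrite ler_pdivlMr; [nra|lra].
move: nu nl; rewrite !ler_norml => /andP[nu1 nu2] /andP[nl1 nl2].
by apply/andP; split; lra.
Qed.

(** The Levy continuity theorem for a standard Gaussian limit, tested on one interval. *)
Lemma mean_itv_cvg (R : realType) (s : nat -> seq R) (a b : R) :
  (forall t : R, mean (s n) (fun x => cos (t * x)) @[n --> \oo] -->
     expR (- (t ^+ 2 / 2))) ->
  (forall t : R, mean (s n) (fun x => sin (t * x)) @[n --> \oo] --> (0 : R)) ->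
  mean (s n) (fun x => ((x \in `[a, b]) : nat)%:R) @[n --> \oo] -->
  \int[lebesgue_measure]_(x in `[a, b]) gauss 1 x.
Proof.
move=> cos_cvg sin_cvg.
have L0 : 0 <= \int[lebesgue_measure]_(x in `[a, b]) gauss (1 : R) x.
  by apply: Rintegral_ge0 => y _; exact: gauss_ge0.
have L1 : \int[lebesgue_measure]_(x in `[a, b]) gauss (1 : R) x <= 1.
  have := @integral_gauss_shift_le1 R 1 `[a, b]%classic 0 (measurable_itv _) ltr01.
  by under eq_Rintegral do rewrite subr0.
apply/cvgrPdist_le => e e0.
(* The same e / 16 is the strip width and the bound for all the errors. The variance is chosen next,
   and n last. *)
have r0 : 0 < e / 16 by rewrite divr_gt0.
have M0 := sqr_ge0 (`|a| + `|b|).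
near (0 : R)^'+ => v.
have [v0 ve te eM] : [/\ 0 < v, v < e / 16,
    Num.sqrt 2 * expR (- ((e / 16) ^+ 2 / (4 * v))) <= e / 16 &
    expR ((`|a| + `|b|) ^+ 2 * v / 2) <= 1 + e / 16].
  by near: v; exact: near_small_variance.
have := @mean_gauss_itv_cvg R s cos_cvg sin_cvg v (a - e / 16) (b + e / 16) v0.
move/cvgrPdist_le => /(_ _ r0) hu.
have := @mean_gauss_itv_cvg R s cos_cvg sin_cvg v (a + e / 16) (b - e / 16) v0.
move/cvgrPdist_le => /(_ _ r0) hl.
near=> n.
have -> : e = 16 * (e / 16) by field.
apply: (@sandwich_le R _ v _ _ _ _ _ _
  (mean (s n) (fun x => \int[lebesgue_measure]_(y in `[a - e / 16, b + e / 16]) gauss v (y - x)))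
  (mean (s n) (fun x => \int[lebesgue_measure]_(y in `[a + e / 16, b - e / 16]) gauss v (y - x)))
  r0 v0 ve L0 L1 te eM (gauss_itv_upper a b v0 (ltW r0))
  (gauss_itv_lower a b v0 (ltW r0))).
- by near: n; exact: hu.
- by near: n; exact: hl.
- set t := _ * expR _.
  apply: (@le_trans _ _ (mean (s n) (fun x =>
      \int[lebesgue_measure]_(y in `[a - e / 16, b + e / 16]) gauss v (y - x) + t))).
    by apply: ler_mean => x; exact: indic_le_smoothed (ltW r0).
  by rewrite meanD lerD2l mean_cst_le// mulr_ge0 ?sqrtr_ge0 ?expR_ge0.
- set t := _ * expR _.
  apply: (@le_trans _ _ (mean (s n) (fun x => ((x \in `[a, b]) : nat)%:R + t))).
    by apply: ler_mean => x; exact: smoothed_le_indic (ltW r0).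
  by rewrite meanD lerD2l mean_cst_le// mulr_ge0 ?sqrtr_ge0 ?expR_ge0.
Unshelve. all: by end_near. Qed.

(** Beyond some K each deviation P k - L N k is at most e/2 times N k. The fixed head [S K] is
    absorbed because the sum of the N k is at least l, hence unbounded. *)
Lemma weighted_cesaro (R : realType) (P N : nat -> R) (L : R) :
  (forall k, 1 <= N k) -> P k / N k @[k --> \oo] --> L ->
  (\sum_(k < l.+1) P k) / (\sum_(k < l.+1) N k) @[l --> \oo] --> L.
Proof.
move=> N1 PN; apply/cvgrPdist_le => e e0.
have e20 : 0 < e / 2 by rewrite divr_gt0.
have N0 k : 0 < N k by exact: lt_le_trans (N1 k).
have /cvgrPdist_le/(_ _ e20)[K _ dK] := PN.
pose S l := \sum_(k < l) P k - L * \sum_(k < l) N k.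
have SS l : S l.+1 = S l + (P l - L * N l).
  by rewrite /S !big_ord_recr /=; ring.
have bnd m : `|S (K + m)%N| <= `|S K| + e / 2 * \sum_(k < (K + m)%N) N k.
  elim: m => [|m IH].
    rewrite addn0 lerDl mulr_ge0 ?(ltW e20)// sumr_ge0// => k _.
    exact: ltW.
  rewrite addnS SS big_ord_recr /= mulrDr [leRHS]addrA.
  apply: le_trans (ler_normD _ _) _; apply: lerD; first exact: IH.
  have := dK (K + m)%N (leq_addr _ _).
  have -> : L - P (K + m)%N / N (K + m)%N =
      - ((P (K + m)%N - L * N (K + m)%N) / N (K + m)%N).
    by field; rewrite gt_eqF.
  by rewrite normrN normrM normfV (gtr0_norm (N0 _)) ler_pdivrMr.
have Nl l : l%:R <= \sum_(k < l) N k.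
  elim: l => [|l IH]; first by rewrite big_ord0.
  by rewrite big_ord_recr /= -natr1 lerD.
near=> l.
have NS : 0 < \sum_(k < l.+1) N k by apply: lt_le_trans (Nl _); rewrite ltr0n.
have -> : L - (\sum_(k < l.+1) P k) / (\sum_(k < l.+1) N k) =
    - (S l.+1 / \sum_(k < l.+1) N k) by rewrite /S; field; rewrite gt_eqF.
rewrite normrN normrM normfV (gtr0_norm NS) ler_pdivrMr//.
have Kl : (K <= l.+1)%N by apply: leqW; near: l; exists K.
rewrite -(subnKC Kl); apply: le_trans (bnd _) _; rewrite subnKC//.
have lS : 2 * `|S K| / e <= l%:R by near: l; exact: nbhs_infty_ger.
have : 2 * `|S K| / e <= \sum_(k < l.+1) N k.
  by apply: le_trans (Nl _); apply: le_trans lS _; rewrite ler_nat.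
by rewrite ler_pdivrMr// => h; lra.
Unshelve. all: by end_near. Qed.

(** * Counting cyclically reduced words *)

Section Words.
Variable n : nat.
Implicit Types (x y z : letter n) (w : seq (letter n)).

Fixpoint words k : seq (seq (letter n)) :=
  if k is k'.+1 then [seq x :: w | x <- enum {: letter n}, w <- words k']
  else [:: [::]].

Lemma mem_words k w : (w \in words k) = (size w == k).
Proof.
elim: k w => [|k IH] w; first by case: w.
apply/allpairsP/idP => [[[x w'] /= [_ + ->]]|]; first by rewrite IH.
by case: w => [|x w] //= wk; exists (x, w); rewrite /= mem_enum IH.
Qed.

Lemma uniq_words k : uniq (words k).
Proof.
elim: k => [|k IH] //=; apply: allpairs_uniq => //; first exact: enum_uniq.
by move=> [x w] [y w'] _ _ /= [-> ->].
Qed.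

(** The only new adjacency in [w ++ w] is that of the last letter with the first, which is the
    closing edge of the cycle. *)
Lemma reduced_cat_self w : reduced (w ++ w) = cycle (fun x y => y != letter_inv x) w.
Proof.
case: w => [|x w] //; rewrite /reduced /= cat_path /= rcons_path.
by case: (path _ x w); rewrite ?andbT ?andbF //= andbA andbC.
Qed.

Definition cyclic_words k := [seq w <- words k | reduced (w ++ w)].

Variables (K : comNzRingType) (u : letter n -> K).
Hypothesis uV : forall x, u x * u (letter_inv x) = 1.

(** The weighted non-backtracking (Hashimoto) operator of the bouquet of n circles, whose oriented
    edges are the letters. *)
Definition transfer (f : letter n -> K) x : K :=
  \sum_(y | y != letter_inv x) u y * f y.

Lemma iter_transfer k f x : iter k transfer f x =
  \sum_(w <- words k | path (fun x y => y != letter_inv x) x w)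
     (\prod_(y <- w) u y) * f (last x w).
Proof.
elim: k x => [|k IH] x; first by rewrite /= big_mkcond big_seq1 big_nil /= mul1r.
rewrite iterS /transfer [RHS]big_mkcond big_allpairs_dep big_enum /= big_mkcond.
apply: eq_bigr => y _; rewrite IH; case: ifP => yx; last first.
  by rewrite big1.
rewrite mulr_sumr big_mkcond; apply: eq_bigr => w _.
by rewrite /= big_cons mulrA.
Qed.

Definition transfer_trace k : K :=
  \sum_x iter k transfer (fun z => (z == x)%:R) x.

(** A closed path is started from the last letter of its word, so each word is counted once. At k =
    0 it would fail: the trace is 2n, but there is a single empty word. *)
Lemma sum_cyclic_words k : (0 < k)%N ->
  \sum_(w <- cyclic_words k) \prod_(y <- w) u y = transfer_trace k.
Proof.
case: k => // k _; rewrite big_filter /transfer_trace.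
under [RHS]eq_bigr => x _ do rewrite iter_transfer big_mkcond.
rewrite exchange_big /= big_mkcond; apply: eq_big_seq => -[|y w].
  by rewrite (mem_words k.+1).
move=> _; rewrite reduced_cat_self (cycle_path y) /=.
(* The delta function leaves only the starting letter x equal to the last letter of the word. *)
rewrite (bigD1 (last y w)) //= eqxx mulr1 [X in _ + X]big1 ?addr0 // => x xl.
by rewrite [_ == x]eq_sym (negPf xl) mulr0 if_same.
Qed.

(** Rank-one operator minus the twisted flip f |-> (x |-> u(x^-1) f(x^-1)), which squares to the
    identity by [uV]. *)
Lemma transferE f x :
  transfer f x = \sum_y u y * f y - u (letter_inv x) * f (letter_inv x).
Proof. by rewrite (bigD1 (letter_inv x)) //= addrC addrK. Qed.

Lemma iter_transferB k a b f g : iter k transfer (fun z => a * f z - b * g z) =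
  (fun z => a * iter k transfer f z - b * iter k transfer g z).
Proof.
elim: k => [|k IH] //=; rewrite IH; apply/funext => x.
rewrite /transfer !mulr_sumr -sumrB; apply: eq_bigr => y _; ring.
Qed.

Lemma transfer_delta x : transfer (fun z => (z == x)%:R) =
  (fun z => u x * 1 - u x * (z == letter_inv x)%:R).
Proof.
apply/funext => z; rewrite transferE (bigD1 x) //= eqxx big1 ?addr0; last first.
  by move=> y /negPf ->; rewrite mulr0.
rewrite (inv_eq (@letter_invK n)); congr (_ - _).
by case: eqP => [->|_]; rewrite ?letter_invK ?mulr0.
Qed.

Lemma iter_transfer_delta k x : iter k.+1 transfer (fun z => (z == x)%:R) =
  (fun z => u x * iter k transfer (fun=> 1) z -
            u x * iter k transfer (fun z => (z == letter_inv x)%:R) z).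
Proof. by rewrite iterSr transfer_delta iter_transferB. Qed.

(** Two steps lead from the delta at x through the one at its inverse and back, with factor u(x)
    u(x^-1) = 1. Everything else lies in the orbit of the constant function. *)
Lemma transfer_trace_rec k : transfer_trace k.+2 = transfer_trace k +
  (\sum_x u x * iter k.+1 transfer (fun=> 1) x - \sum_x iter k transfer (fun=> 1) x).
Proof.
rewrite /transfer_trace -sumrB -big_split; apply: eq_bigr => x _.
rewrite iter_transfer_delta (iter_transfer_delta _ (letter_inv x)) letter_invK.
have := uV x; set a := u x; set b := u _.
set p := iter _ _ _ _; set q := iter _ _ _ _; set r := iter _ _ _ _ => ab.
have -> : a * p - a * (b * q - b * r) = a * p - a * b * (q - r) by ring.
by rewrite ab /=; ring.
Qed.

Lemma transfer_trace1 : transfer_trace 1 = \sum_x u x.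
Proof.
apply: eq_bigr => x _; rewrite iter_transfer_delta /= mulr1.
case: x => i []; by rewrite /letter_inv /= xpair_eqE andbF mulr0 subr0.
Qed.

Lemma sum_letter_inv (f : letter n -> K) : \sum_x f (letter_inv x) = \sum_x f x.
Proof. by rewrite [RHS](reindex_inj (inv_inj (@letter_invK n))). Qed.

Variables lam mu : K.
Hypothesis lamDmu : lam + mu = \sum_x u x.
Hypothesis lamMmu : lam * mu = 2 * n%:R - 1.

Lemma card_letter : #|{: letter n}| = (2 * n)%N.
Proof. by rewrite card_prod card_ord card_bool mulnC. Qed.

(* The span of the constant function and of [x |-> u (letter_inv x)] is stable
   under [transfer], which acts there with characteristic polynomial
   X^2 - (lam + mu) X + lam mu. *)
Lemma transfer_affine p r : transfer (fun x => p - r * u (letter_inv x)) =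
  (fun x => ((lam + mu) * p - lam * mu * r) - p * u (letter_inv x)).
Proof.
apply/funext => x; rewrite transferE letter_invK.
under eq_bigr => y _ do rewrite mulrBr mulrCA uV mulr1.
rewrite sumrB sumr_const card_letter -mulr_suml -lamDmu lamMmu.
rewrite -[r *+ _]mulr_natr natrM.
have := uV x; set a := u x; set b := u _ => ab.
by rewrite mulrBr [b * (r * a)]mulrCA [b * a]mulrC ab; ring.
Qed.

(** The witnesses are the complete homogeneous polynomials h_k and h_(k-1) in lam and mu, and 2 h_k
    - (lam + mu) h_(k-1) is the k-th power sum. Two consecutive identities are carried since the
    recursion has order 2; no division by lam - mu occurs. *)
Lemma iter_transfer1 k : exists p r : K,
  [/\ iter k transfer (fun=> 1) = (fun x => p - r * u (letter_inv x)),
      2 * p - r * (lam + mu) = lam ^+ k + mu ^+ k &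
      2 * ((lam + mu) * p - lam * mu * r) - p * (lam + mu) = lam ^+ k.+1 + mu ^+ k.+1].
Proof.
elim: k => [|k [p [r [E V0 V1]]]].
  exists 1, 0; split; first by apply/funext => x /=; ring.
    by rewrite !expr0; ring.
  by rewrite !expr1; ring.
exists ((lam + mu) * p - lam * mu * r), p; split.
- by rewrite iterS E transfer_affine.
- by rewrite V1.
- rewrite (_ : lam ^+ k.+2 + mu ^+ k.+2 = (lam + mu) * (lam ^+ k.+1 + mu ^+ k.+1)
    - lam * mu * (lam ^+ k + mu ^+ k)); last by rewrite !exprS; ring.
  by rewrite -V0 -V1; ring.
Qed.

Lemma transfer_traceE k : (0 < n)%N ->
  transfer_trace k = lam ^+ k + mu ^+ k + (n%:R - 1) * (1 + (-1) ^+ k).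
Proof.
move=> n0.
suff : transfer_trace k = lam ^+ k + mu ^+ k + (n%:R - 1) * (1 + (-1) ^+ k) /\
  transfer_trace k.+1 = lam ^+ k.+1 + mu ^+ k.+1 + (n%:R - 1) * (1 + (-1) ^+ k.+1) by case.
elim: k => [|k [IH0 IH1]].
  split; last by rewrite transfer_trace1 -lamDmu !expr1; ring.
  rewrite /transfer_trace; under eq_bigr => x _ do rewrite /= eqxx.
  by rewrite sumr_const card_letter natrM !expr0; ring.
split=> //; rewrite transfer_trace_rec IH0.
have [p [r [E V0 V1]]] := iter_transfer1 k.
have -> : \sum_x iter k transfer (fun=> 1) x = 2 * n%:R * p - r * (lam + mu).
  rewrite E sumrB sumr_const card_letter -mulr_sumr sum_letter_inv -lamDmu.
  by rewrite -[p *+ _]mulr_natr natrM; ring.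
have -> : \sum_x u x * iter k.+1 transfer (fun=> 1) x =
    (lam + mu) * ((lam + mu) * p - lam * mu * r) - 2 * n%:R * p.
  rewrite iterS E transfer_affine; under eq_bigr => x _ do rewrite mulrBr mulrCA uV mulr1.
  by rewrite sumrB sumr_const card_letter -mulr_suml -lamDmu -[p *+ _]mulr_natr natrM; ring.
rewrite (_ : lam ^+ k.+2 + mu ^+ k.+2 = (lam + mu) * (lam ^+ k.+1 + mu ^+ k.+1)
    - lam * mu * (lam ^+ k + mu ^+ k)); last by rewrite !exprS; ring.
rewrite -V1 -V0 (exprS _ k.+1) (exprS _ k).
have -> : 2 * n%:R = lam * mu + 1 by rewrite lamMmu; ring.
ring.
Qed.

End Words.

(** * The transfer operator with weights exp(i t log_j) *)

Section CyclicWordSums.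
Variables (R : realType) (n : nat) (j : 'I_n).
Implicit Types (x : letter n) (w : seq (letter n)).

Definition letter_log x : int := if x.1 == j then if x.2 then 1 else -1 else 0.

Definition word_log w : int := \sum_(x <- w) letter_log x.

Lemma letter_log_inv x : letter_log (letter_inv x) = - letter_log x.
Proof. by case: x => i []; rewrite /letter_log /=; case: ifP; rewrite ?opprK ?oppr0. Qed.

Definition cis (t : R) : R[i] := (cos t +i* sin t)%C.

Lemma cisD s t : cis (s + t) = cis s * cis t.
Proof.
rewrite /cis sinD cosD; apply/eqP; rewrite eq_complex /=.
by rewrite addrC !eqxx [X in _ == X]addrC eqxx.
Qed.

Lemma cis0 : cis 0 = 1.
Proof. by rewrite /cis sin0 cos0. Qed.

Variable t : R.

Definition letter_cis x : R[i] := cis (t * (letter_log x)%:~R).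

Lemma letter_cisV x : letter_cis x * letter_cis (letter_inv x) = 1.
Proof. by rewrite -cisD letter_log_inv rmorphN mulrN subrr cis0. Qed.

Lemma prod_letter_cis w : \prod_(x <- w) letter_cis x = cis (t * (word_log w)%:~R).
Proof.
elim: w => [|x w IH]; first by rewrite /word_log !big_nil mulr0 cis0.
by rewrite /word_log !big_cons IH -cisD rmorphD mulrDr.
Qed.

Lemma sum_letter_cis : \sum_x letter_cis x = (2 * (n%:R - 1) + 2 * cos t)%:C%C.
Proof.
have E i : letter_cis (i, true) + letter_cis (i, false) =
    (2 + (i == j)%:R * (2 * cos t - 2))%:C%C.
  rewrite /letter_cis /letter_log /= /cis; case: ifP => _; apply/eqP; rewrite eq_complex /=.
    rewrite rmorphN !mulr1 mulrN1 cosN sinN subrr eqxx andbT.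
    by apply/eqP; ring.
  by rewrite mulr0 cos0 sin0 addr0 mul0r addr0 !eqxx.
have -> : \sum_x letter_cis x = \sum_(i < n) (letter_cis (i, true) + letter_cis (i, false)).
  rewrite (eq_bigr (fun i => \sum_b letter_cis (i, b))); last first.
    by move=> i _; rewrite big_bool.
  by rewrite pair_bigA; apply: eq_bigr => -[].
under eq_bigr do rewrite E.
rewrite -rmorph_sum big_split /= -mulr_suml sumr_const card_ord.
rewrite (bigD1 j) //= eqxx big1 ?addr0 => [|i /negPf -> //].
by congr (_%:C)%C; rewrite -[2 *+ n]mulr_natr mulr1n; ring.
Qed.

Lemma sum_cyclic_cis (lam mu : R) k : (0 < k)%N ->
  lam + mu = 2 * (n%:R - 1) + 2 * cos t -> lam * mu = 2 * n%:R - 1 ->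
  \sum_(w <- cyclic_words n k) cis (t * (word_log w)%:~R) =
  (lam ^+ k + mu ^+ k + (n%:R - 1) * (1 + (-1) ^+ k))%:C%C.
Proof.
move=> k0 lamD lamM; have n0 : (0 < n)%N by case: (n) j => // -[].
under eq_bigr do rewrite -prod_letter_cis.
rewrite sum_cyclic_words//.
rewrite (@transfer_traceE _ _ _ letter_cisV lam%:C%C mu%:C%C) //.
- by rewrite !rmorphD !rmorphM !rmorphD !rmorphN !rmorphXn !rmorphN !rmorph1 rmorph_nat.
- by rewrite -rmorphD lamD sum_letter_cis.
- by rewrite -rmorphM lamM rmorphB rmorphM !rmorph_nat rmorph1.
Qed.

Lemma sum_cyclic_cos (lam mu : R) k : (0 < k)%N ->
  lam + mu = 2 * (n%:R - 1) + 2 * cos t -> lam * mu = 2 * n%:R - 1 ->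
  \sum_(w <- cyclic_words n k) cos (t * (word_log w)%:~R) =
  lam ^+ k + mu ^+ k + (n%:R - 1) * (1 + (-1) ^+ k).
Proof.
move=> k0 lamD lamM; have /(congr1 (@complex.Re R)) := sum_cyclic_cis k0 lamD lamM.
by rewrite raddf_sum.
Qed.

Lemma sum_cyclic_sin (lam mu : R) k : (0 < k)%N ->
  lam + mu = 2 * (n%:R - 1) + 2 * cos t -> lam * mu = 2 * n%:R - 1 ->
  \sum_(w <- cyclic_words n k) sin (t * (word_log w)%:~R) = 0.
Proof.
move=> k0 lamD lamM; have /(congr1 (@complex.Im R)) := sum_cyclic_cis k0 lamD lamM.
by rewrite raddf_sum.
Qed.

End CyclicWordSums.

Lemma size_cyclic_words (R : realType) n k : (0 < n)%N -> (0 < k)%N ->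
  (size (cyclic_words n k))%:R =
  (2 * n%:R - 1) ^+ k + 1 + (n%:R - 1) * (1 + (-1) ^+ k) :> R.
Proof.
move=> n0 k0.
have uV (x : letter n) : (1 : R) * 1 = 1 by rewrite mulr1.
have := sum_cyclic_words (fun _ : letter n => 1 : R) k0.
under eq_bigr do rewrite big1_eq.
rewrite big_const_seq count_predT iter_addr addr0 => ->.
rewrite (@transfer_traceE _ _ _ uV (2 * n%:R - 1) 1) ?expr1n // ?mulr1 //.
by rewrite sumr_const card_letter natrM; ring.
Qed.

(** * Asymptotics of the characteristic functions *)

(** Squeeze by 1 - x <= exp(- x) and 1 / (1 - x) = 1 + x / (1 - x) <= exp(x / (1 - x)). *)
Lemma cvg_one_minus_expn (R : realType) (x : nat -> R) (c : R) :
  x k @[k --> \oo] --> 0 -> k%:R * x k @[k --> \oo] --> c ->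
  (1 - x k) ^+ k @[k --> \oo] --> expR (- c).
Proof.
move=> x0 kx.
apply: (@squeeze_cvgr _ _ _ _ (fun k => expR (- (k%:R * x k * (1 - x k)^-1)))
  (fun k => expR (- (k%:R * x k)))).
- near=> k.
  have xk : 0 < 1 - x k.
    by rewrite subr_gt0; near: k; apply: (cvgr_lt _ x0).
  apply/andP; split; last first.
    rewrite -mulrN expRM_natl lerXn2r ?nnegrE ?expR_ge0 ?(ltW xk)//.
    exact: expR_ge1Dx.
  rewrite -mulrA -mulrN expRM_natl lerXn2r ?nnegrE ?expR_ge0 ?(ltW xk)//.
  rewrite expRN -[leRHS]invrK lef_pV2 ?posrE ?expR_gt0 ?invr_gt0//.
  apply: le_trans (expR_ge1Dx _).
  by rewrite le_eqVlt; apply/orP; left; apply/eqP; field; rewrite gt_eqF.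
- apply: (cvg_comp (fun k => - (k%:R * x k * (1 - x k)^-1)) expR); last exact: continuous_expR.
  apply: cvgN; rewrite -[X in _ --> X]mulr1; apply: cvgM => //.
  rewrite -[X in _ --> X]invr1; apply: cvgV; first exact: oner_neq0.
  rewrite -[X in _ --> X]subr0; apply: cvgB => //; exact: cvg_cst.
- apply: (cvg_comp (fun k => - (k%:R * x k)) expR); last exact: continuous_expR.
  exact: cvgN.
Unshelve. all: by end_near. Qed.

Section LengthAsymptotics.
Variables (R : realType) (n : nat) (t : R).
Hypothesis n2 : (2 <= n)%N.

Let q : R := 2 * n%:R - 1.
Let theta k : R := t * Num.sqrt ((n%:R - 1) / k%:R).
Let tr k : R := 2 * (n%:R - 1) + 2 * cos (theta k).
Let disc k : R := tr k ^+ 2 - 4 * q.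
(** For small k the discriminant may be negative and its square root is then 0; these are the roots
    only once [disc_ge0] holds. *)
Let lam k : R := (tr k + Num.sqrt (disc k)) / 2.
Let mu k : R := (tr k - Num.sqrt (disc k)) / 2.

Let n_ge2 : 2 <= n%:R :> R.
Proof. by rewrite ler_nat. Qed.

Let q_ge3 : 3 <= q.
Proof. by have := n_ge2; rewrite /q; lra. Qed.

Let theta_sqr k : (0 < k)%N -> k%:R * theta k ^+ 2 = t ^+ 2 * (n%:R - 1).
Proof.
have n_ge := n_ge2; have q_ge := q_ge3.
move=> k0; have k0' : k%:R != 0 :> R by rewrite pnatr_eq0 -lt0n.
rewrite /theta exprMn sqr_sqrtr; first by field.
by rewrite divr_ge0// subr_ge0; lra.
Qed.

Let theta0 : theta k @[k --> \oo] --> 0.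
Proof.
rewrite -(mulr0 t); apply: cvgM; first exact: cvg_cst.
rewrite -(sqrtr0 R).
apply: (cvg_comp (fun k => (n%:R - 1) / k%:R) Num.sqrt); last exact: sqrt_continuous.
rewrite -(mulr0 (n%:R - 1)); apply: cvgM; first exact: cvg_cst.
by rewrite -cvg_shiftS; exact: cvg_harmonic.
Qed.

Let delta k : R := 2 - 2 * cos (theta k).

Let delta_cvg0 : delta k @[k --> \oo] --> 0.
Proof.
rewrite -(subrr 2) -[X in _ - X]mulr1 -[X in _ * X](@cos0 R).
apply: cvgB; first exact: cvg_cst; apply: cvgM; first exact: cvg_cst.
by apply: (cvg_comp theta cos); [exact: theta0|exact: continuous_cos].
Qed.

Let delta_cvg : k%:R * delta k @[k --> \oo] --> t ^+ 2 * (n%:R - 1).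
Proof.
(* Write sin y = g(y) y with g continuous at 0 and g(0) = 1; then 2 - 2 cos theta = 4 sin^2(theta /
   2) = g(theta / 2)^2 theta^2. *)
have := is_derive_sin (0 : R); rewrite cos0.
move=> /is_derive1_caratheodory[g [gE cg g0]].
have sinE (y : R) : sin y = g y * y.
  by have := gE y; rewrite sin0 !subr0.
have dE k : delta k = g (theta k / 2) ^+ 2 * theta k ^+ 2.
  rewrite /delta {1}(splitr (theta k)) cosD -!expr2 !sinE.
  have -> : cos (theta k / 2) ^+ 2 = 1 - (g (theta k / 2) * (theta k / 2)) ^+ 2.
    by apply/eqP; rewrite -sinE eq_sym subr_eq cos2Dsin2.
  by field.
have gc : g (theta k / 2) @[k --> \oo] --> (1 : R).
  have hc : theta k / 2 @[k --> \oo] --> 0.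
    by rewrite -(mul0r (2^-1)); apply: cvgM; [exact: theta0|exact: cvg_cst].
  by rewrite -[X in _ --> X]g0; exact: (cvg_comp _ _ hc cg).
have h : g (theta k / 2) * g (theta k / 2) * (t ^+ 2 * (n%:R - 1)) @[k --> \oo] -->
    1 * 1 * (t ^+ 2 * (n%:R - 1)).
  by apply: cvgM; [exact: cvgM|exact: cvg_cst].
rewrite !mul1r in h; apply: cvg_trans h; apply: near_eq_cvg; near=> k.
by rewrite dE [RHS]mulrCA theta_sqr ?expr2//; near: k; exists 1%N.
Unshelve. all: by end_near. Qed.

Let trE k : tr k = q + 1 - delta k.
Proof. by rewrite /tr /q /delta; ring. Qed.

Let sqrt_disc_cvg : Num.sqrt (disc k) @[k --> \oo] --> q - 1.
Proof.
have n_ge := n_ge2; have q_ge := q_ge3.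
have -> : q - 1 = Num.sqrt ((q - 1) ^+ 2) by rewrite sqrtr_sqr ger0_norm//; lra.
have c : q + 1 - delta k @[k --> \oo] --> q + 1 - 0.
  by apply: cvgB; [exact: cvg_cst|exact: delta_cvg0].
have dc : disc k @[k --> \oo] --> (q - 1) ^+ 2.
  have -> : (q - 1) ^+ 2 = (q + 1 - 0) * (q + 1 - 0) - 4 * q by ring.
  rewrite /disc; under eq_fun do rewrite trE expr2.
  by apply: cvgB; [exact: cvgM|exact: cvg_cst].
exact: (cvg_comp _ _ dc (@sqrt_continuous R _)).
Qed.

Let disc_ge0 : \forall k \near \oo, 0 <= disc k.
Proof.
have n_ge := n_ge2; have q_ge := q_ge3.
have q0 : 0 < q - 1 by lra.
(* The square root of a negative number is 0, so a positive root forces a positive discriminant. *)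
near=> k; suff : 0 < Num.sqrt (disc k) by rewrite sqrtr_gt0 => /ltW.
by near: k; exact: (cvgr_gt _ sqrt_disc_cvg).
Unshelve. all: by end_near. Qed.

Let lamDmu k : lam k + mu k = tr k.
Proof. by rewrite /lam /mu; field. Qed.

Let lamMmu k : 0 <= disc k -> lam k * mu k = q.
Proof.
move=> d0; have -> : lam k * mu k = (tr k ^+ 2 - Num.sqrt (disc k) ^+ 2) / 4.
  by rewrite /lam /mu; field.
by rewrite sqr_sqrtr// /disc; field.
Qed.

Let tr_cvg : tr k @[k --> \oo] --> q + 1.
Proof.
have : q + 1 - delta k @[k --> \oo] --> q + 1 - 0.
  by apply: cvgB; [exact: cvg_cst|exact: delta_cvg0].
by rewrite subr0; under eq_fun do rewrite -trE.
Qed.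

Let x k : R := 1 - lam k / q.

Let x_cvg0 : x k @[k --> \oo] --> 0.
Proof.
have n_ge := n_ge2; have q_ge := q_ge3.
have -> : 0 = 1 - (q + 1 + (q - 1)) / 2 / q by field; lra.
apply: cvgB; first exact: cvg_cst; apply: cvgM; last exact: cvg_cst.
by apply: cvgM; last exact: cvg_cst; apply: cvgD.
Qed.

(* The characteristic equation of [lam k], solved for [x k] to first order. *)
Let xE k : 0 <= disc k -> x k * (q - 1 + delta k - q * x k) = delta k.
Proof.
have n_ge := n_ge2; have q_ge := q_ge3.
move=> /lamMmu lm; have q0 : q != 0 by rewrite gt_eqF//; lra.
have lE : lam k * (tr k - lam k) = q by rewrite -lamDmu addrC addKr.
have lx : lam k = q * (1 - x k) by rewrite /x; field.
apply: (mulfI q0); move: lE; rewrite lx trE => /eqP; rewrite -subr_eq0 => /eqP lE.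
apply/eqP; rewrite -subr_eq0; apply/eqP; rewrite -[RHS]lE; ring.
Qed.

(** To first order x is delta / (q - 1), and q - 1 = 2(n - 1) cancels the factor n - 1 of the
    normalisation. *)
Let kx_cvg : k%:R * x k @[k --> \oo] --> t ^+ 2 / 2.
Proof.
have n_ge := n_ge2; have q_ge := q_ge3.
have dc : q - 1 + delta k - q * x k @[k --> \oo] --> q - 1 + 0 - q * 0.
  apply: cvgB; first by apply: cvgD; [exact: cvg_cst|exact: delta_cvg0].
  by apply: cvgM; [exact: cvg_cst|exact: x_cvg0].
rewrite addr0 mulr0 subr0 in dc.
have q1 : 0 < q - 1 by lra.
have -> : t ^+ 2 / 2 = t ^+ 2 * (n%:R - 1) * (q - 1)^-1.
  by rewrite /q; field; rewrite gt_eqF//; lra.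
have h : k%:R * delta k * (q - 1 + delta k - q * x k)^-1 @[k --> \oo] -->
    t ^+ 2 * (n%:R - 1) * (q - 1)^-1.
  by apply: cvgM; [exact: delta_cvg|exact: (cvgV (lt0r_neq0 q1) dc)].
apply: cvg_trans h; apply: near_eq_cvg; near=> k.
have dk : 0 <= disc k by near: k; exact: disc_ge0.
have d0 : q - 1 + delta k - q * x k != 0.
  by rewrite gt_eqF//; near: k; exact: (cvgr_gt _ dc).
by apply: (mulIf d0); rewrite divfK// -mulrA xE.
Unshelve. all: by end_near. Qed.

Let lam_pow_cvg : (lam k / q) ^+ k @[k --> \oo] --> expR (- (t ^+ 2 / 2)).
Proof.
have := cvg_one_minus_expn x_cvg0 kx_cvg.
by under eq_fun do rewrite /x opprB addrC subrK.
Qed.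

Let half_pow_cvg0 : (2^-1 : R) ^+ k @[k --> \oo] --> 0.
Proof. have q_ge := q_ge3; by apply: cvg_expr; rewrite ger0_norm//; lra. Qed.

(** mu / q tends to 1/q <= 1/3, so its modulus is eventually below 1/2. *)
Let mu_pow_cvg : (mu k / q) ^+ k @[k --> \oo] --> 0.
Proof.
have n_ge := n_ge2; have q_ge := q_ge3.
have mc : mu k / q @[k --> \oo] --> (q + 1 - (q - 1)) / 2 / q.
  apply: cvgM; last exact: cvg_cst.
  by apply: cvgM; last exact: cvg_cst; apply: cvgB.
have mq : (q + 1 - (q - 1)) / 2 / q = q^-1 by field; lra.
rewrite mq in mc.
have q2 : q^-1 < 2^-1 by rewrite ltf_pV2 ?posrE; lra.
have q3 : - 2^-1 < q^-1 by apply: (@lt_trans _ _ 0); rewrite ?invr_gt0; lra.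
apply: (@squeeze_cvgr _ _ _ _ (fun k => - (2^-1) ^+ k) (fun k => (2^-1) ^+ k)) => //.
  near=> k; rewrite -ler_norml normrX lerXn2r ?nnegrE//.
  rewrite ler_norml; apply/andP; split; apply: ltW; near: k.
    exact: (cvgr_gt _ mc).
  exact: (cvgr_lt _ mc).
by rewrite -oppr0; exact: cvgN.
Unshelve. all: by end_near. Qed.

Let parity k : R := (n%:R - 1) * (1 + (-1) ^+ k).

Let parity_cvg : parity k / q ^+ k @[k --> \oo] --> 0.
Proof.
have n_ge := n_ge2; have q_ge := q_ge3.
apply: (@squeeze_cvgr _ _ _ _ (fun k => 0) (fun k => 2 * (n%:R - 1) * (2^-1) ^+ k)) => //.
- near=> k; have [s1 s2] : 0 <= 1 + (-1) ^+ k :> R /\ 1 + (-1) ^+ k <= 2 :> R.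
    by rewrite -signr_odd; case: (odd k); rewrite ?expr1 ?expr0; split; lra.
  have qk : 0 < q ^+ k by rewrite exprn_gt0//; lra.
  rewrite /parity divr_ge0 ?(ltW qk) ?mulr_ge0 ?subr_ge0//=; try lra.
  apply: ler_pM; rewrite ?mulr_ge0 ?invr_ge0 ?subr_ge0 ?(ltW qk)//; first lra.
    by rewrite mulrC ler_wpM2r// subr_ge0; lra.
  by rewrite -exprVn lerXn2r ?nnegrE ?invr_ge0//; [lra|rewrite lef_pV2 ?posrE; lra].
- exact: cvg_cst.
- rewrite -(mulr0 (2 * (n%:R - 1))); apply: cvgM; [exact: cvg_cst|exact: half_pow_cvg0].
Unshelve. all: by end_near. Qed.

Let size_cvg : (size (cyclic_words n k))%:R / q ^+ k @[k --> \oo] --> (1 : R).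
Proof.
have n_ge := n_ge2; have q_ge := q_ge3.
have q1 : `|q^-1| < 1 by rewrite ger0_norm ?invr_ge0 ?invf_lt1; lra.
have : 1 + q^-1 ^+ k + parity k / q ^+ k @[k --> \oo] --> (1 + 0 + 0 : R).
  by apply: cvgD => //; apply: cvgD; [exact: cvg_cst|exact: cvg_expr].
rewrite !addr0 => h; apply: cvg_trans h; apply: near_eq_cvg; near=> k.
have k0 : (0 < k)%N by near: k; exists 1%N.
have qk : q ^+ k != 0 by rewrite expf_neq0// gt_eqF//; lra.
have n0 : (0 < n)%N by apply: leq_trans n2.
by rewrite size_cyclic_words// -/(parity k) -/q exprVn; field.
Unshelve. all: by end_near. Qed.

Variable j : 'I_n.

Lemma cos_cyclic_words_cvg :
  (\sum_(w <- cyclic_words n k) cos (theta k * (word_log j w)%:~R)) /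
    (size (cyclic_words n k))%:R @[k --> \oo] --> expR (- (t ^+ 2 / 2)).
Proof.
have n_ge := n_ge2; have q_ge := q_ge3.
have L : (lam k / q) ^+ k + (mu k / q) ^+ k + parity k / q ^+ k @[k --> \oo] -->
    expR (- (t ^+ 2 / 2)) + 0 + 0.
  by apply: cvgD => //; apply: cvgD.
have h : ((lam k / q) ^+ k + (mu k / q) ^+ k + parity k / q ^+ k) *
    ((size (cyclic_words n k))%:R / q ^+ k)^-1 @[k --> \oo] -->
    (expR (- (t ^+ 2 / 2)) + 0 + 0) * 1^-1.
  by apply: cvgM; [exact: L|exact: (cvgV (oner_neq0 R) size_cvg)].
rewrite !addr0 invr1 mulr1 in h.
apply: cvg_trans h; apply: near_eq_cvg; near=> k.
have k0 : (0 < k)%N by near: k; exists 1%N.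
have qk : q ^+ k != 0 by rewrite expf_neq0// gt_eqF//; lra.
have dk : 0 <= disc k by near: k; exact: disc_ge0.
have s0 : (size (cyclic_words n k))%:R / q ^+ k != 0.
  by rewrite gt_eqF//; near: k; exact: (cvgr_gt _ size_cvg).
rewrite (sum_cyclic_cos j k0 (lamDmu k) (lamMmu dk)) -/(parity k) /= !expr_div_n.
move: s0; rewrite mulf_eq0 negb_or => /andP[s0 _].
by field; rewrite s0 qk expf_neq0.
Unshelve. all: by end_near. Qed.

Lemma sin_cyclic_words_cvg :
  (\sum_(w <- cyclic_words n k) sin (theta k * (word_log j w)%:~R)) /
    (size (cyclic_words n k))%:R @[k --> \oo] --> (0 : R).
Proof.
apply: cvg_near_cst; near=> k.
have k0 : (0 < k)%N by near: k; exists 1%N.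
have dk : 0 <= disc k by near: k; exact: disc_ge0.
by rewrite (sum_cyclic_sin j k0 (lamDmu k) (lamMmu dk)) mul0r.
Unshelve. all: by end_near. Qed.

End LengthAsymptotics.

(** * The free group *)

(** A reduced word is the product of its letters in the group, so the morphism is determined by its
    values on them. *)
Lemma morphism_word_log n (j : 'I_n) (log_j : freegroup n -> int) :
  {morph log_j : g h / (g * h)%g >-> g + h} ->
  (forall i, log_j (gen i) = (i == j)%:R) ->
  forall g, log_j g = word_log j (word g).
Proof.
move=> logM logA.
have log1 : log_j 1%g = 0 by apply: (addrI (log_j 1%g)); rewrite -logM mulg1 addr0.
have logx x : log_j (@FreeGroup n [:: x] isT) = letter_log j x.
  case: x => i []; rewrite /letter_log /=.
    by rewrite -[LHS]/(log_j (gen i)) logA; case: eqP.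
  have := logM (gen i) (@FreeGroup n [:: (i, false)] isT).
  have -> : (gen i * @FreeGroup n [:: (i, false)] isT = 1)%g.
    by apply: val_inj; rewrite /= /letter_inv /= eqxx.
  rewrite log1 logA => /esym/eqP; rewrite addr_eq0 -eqr_oppLR => /eqP <-.
  by case: eqP.
case=> w rw /=; elim: w rw => [|x w IH] rw.
  by rewrite /word_log big_nil -log1; congr log_j; apply: val_inj.
rewrite /word_log big_cons -logx -[X in _ + X](IH (path_sorted rw)) -logM.
by congr log_j; apply: val_inj; rewrite /= push_reduced.
Qed.

Lemma count_ball n (Q : pred (seq (letter n))) l (A : set (freegroup n)) :
  (forall g, A g <-> [/\ cyclically_reduced g, (wl g <= l)%N & Q (word g)]) ->
  count_set A = (\sum_(k < l.+1) count Q (cyclic_words n k))%N.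
Proof.
move=> AE.
have finA : finite_set A.
  by apply: sub_finite_set (finite_ball n l) => g /AE[].
pose L := [seq w | k <- iota 0 l.+1, w <- [seq w <- cyclic_words n k | Q w]].
have memL w : (w \in L) = [&& reduced (w ++ w), (size w <= l)%N & Q w].
  apply/allpairsPdep/and3P => [[k [v [kl vk ->]]]|[rw wl_ Qw]].
    move: kl vk; rewrite mem_iota add0n ltnS !mem_filter mem_words /=.
    by move=> kl /and3P[-> -> /eqP->].
  by exists (size w), w; rewrite mem_iota add0n ltnS wl_ !mem_filter mem_words Qw rw eqxx.
have uniqL : uniq L.
  apply: allpairs_uniq_dep; first exact: iota_uniq.
    by move=> k _; rewrite !filter_uniq// uniq_words.
  (* The lists for different k are disjoint, as k is the size of the word. *)
  move=> [k v] [k' v'] /allpairsPdep[k1 [v1 [_ h1 [-> ->]]]].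
  move=> /allpairsPdep[k2 [v2 [_ h2 [-> ->]]]] /= vv.
  move: h1 h2; rewrite !mem_filter !mem_words vv.
  by move=> /and3P[_ _ /eqP <-] /and3P[_ _ /eqP <-].
have sizeL : size L = (\sum_(k < l.+1) count Q (cyclic_words n k))%N.
  rewrite size_allpairs_dep sumnE big_map -[iota 0 _]/(index_iota 0 l.+1) big_mkord.
  by apply: eq_bigr => k _; rewrite size_filter.
rewrite -sizeL /count_set -(size_map (@word n)); apply/perm_size/uniq_perm => //.
  by rewrite (map_inj_uniq val_inj) finmap.fset_uniq.
move=> w; rewrite memL; apply/mapP/and3P => [[g]|[rw wl_ Qw]].
  by rewrite in_fset_set// in_setE => /AE[] ? ? ? ->.
have rw' : reduced w by have [] := cat_sorted2 rw.
by exists (FreeGroup rw') => //; rewrite in_fset_set// in_setE; apply/AE.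
Qed.

(** * The limit law at fixed word length *)

Section CyclicCLT.
Variables (R : realType) (n : nat) (j : 'I_n) (a b : R).
Hypothesis n2 : (2 <= n)%N.

Definition word_normalized_log (w : seq (letter n)) : R :=
  Num.sqrt ((n%:R - 1) / (size w)%:R) * (word_log j w)%:~R.

(** Needed to apply [weighted_cesaro]. For k > 0 the summand 1 of the count suffices; for k = 0
    there is the empty word. *)
Lemma size_cyclic_words_ge1 k : 1 <= (size (cyclic_words n k))%:R :> R.
Proof.
have n2' : 2 <= n%:R :> R by rewrite ler_nat.
case: k => [|k]; first exact: lexx.
have n0 : (0 < n)%N by apply: leq_trans n2.
rewrite size_cyclic_words// -addrA addrCA lerDl addr_ge0//.
  by rewrite exprn_ge0//; lra.
rewrite mulr_ge0//; first by lra.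
by rewrite -signr_odd; case: (odd _); rewrite ?expr0 ?expr1; lra.
Qed.

Lemma cyclic_words_fraction_cvg :
  (count (fun w => word_normalized_log w \in `[a, b]) (cyclic_words n k))%:R /
    (size (cyclic_words n k))%:R @[k --> \oo] -->
  \int[lebesgue_measure]_(x in `[a, b]) gauss 1 x.
Proof.
pose s k := [seq word_normalized_log w | w <- cyclic_words n k].
have sE (f : R -> R) k : mean (s k) f =
    (\sum_(w <- cyclic_words n k)
       f (Num.sqrt ((n%:R - 1) / k%:R) * (word_log j w)%:~R)) / (size (cyclic_words n k))%:R.
  rewrite /mean size_map big_map; congr (_ / _).
  (* All words in the list have size k, so the normalising factor is constant and passes into the
     frequency. *)
  apply: eq_big_seq => w; rewrite mem_filter mem_words => /andP[_ /eqP wk].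
  by rewrite /word_normalized_log wk.
have := @mean_itv_cvg R s a b.
have -> : (fun k => mean (s k) (fun x => ((x \in `[a, b]) : nat)%:R)) =
  (fun k => (count (fun w => word_normalized_log w \in `[a, b]) (cyclic_words n k))%:R /
    (size (cyclic_words n k))%:R).
  apply/funext => k; rewrite /mean size_map big_map; congr (_ / _).
  by rewrite -natr_sum -sum1_count [in RHS]big_mkcond; congr (_%:R);
    apply: eq_bigr => w _; case: ifP.
apply => t; under eq_fun do rewrite sE.
  under eq_fun do under eq_bigr do rewrite mulrA.
  exact: cos_cyclic_words_cvg.
under eq_fun do under eq_bigr do rewrite mulrA.
exact: sin_cyclic_words_cvg.
Qed.

End CyclicCLT.

Theorem theorem1p1 (R : realType) (n : nat) (hn : (2 <= n)%N) (j : 'I_n)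
    (log_j : freegroup n -> int)
    (log_jM : {morph log_j : g h / (g * h)%g >-> g + h})
    (log_jA : forall i : 'I_n, log_j (gen i) = (i == j)%:R)
    (a b : R) (hab : a <= b) :
  (fun l : nat =>
     (count_set [set g : freegroup n | [/\ cyclically_reduced g,
        (wl g <= l)%N & normalized_log R log_j g \in `[a, b]]])%:R /
     (count_set [set g : freegroup n |
        cyclically_reduced g /\ (wl g <= l)%N])%:R : R) @ \oo
  --> (Num.sqrt (2 * pi))^-1 *
      \int[lebesgue_measure]_(x in `[a, b]) expR (- (x ^+ 2 / 2)).
Proof.
have logE := morphism_word_log log_jM log_jA.
have num l : count_set [set g : freegroup n | [/\ cyclically_reduced g,
    (wl g <= l)%N & normalized_log R log_j g \in `[a, b]]] =
    (\sum_(k < l.+1) count (fun w => word_normalized_log R j w \in `[a, b])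
       (cyclic_words n k))%N.
  apply: count_ball => g; rewrite /= /word_normalized_log -logE.
  by [].
have den l : count_set [set g : freegroup n |
    cyclically_reduced g /\ (wl g <= l)%N] = (\sum_(k < l.+1) size (cyclic_words n k))%N.
  rewrite (@count_ball n predT l); last by move=> g /=; split=> [[]|[]].
  by apply: eq_bigr => k _; rewrite count_predT.
have -> : (Num.sqrt (2 * pi))^-1 *
    \int[lebesgue_measure]_(x in `[a, b]) expR (- (x ^+ 2 / 2)) =
    \int[lebesgue_measure]_(x in `[a, b]) gauss (1 : R) x.
  have c0 : Num.sqrt (2 * pi) != 0 :> R by rewrite gt_eqF// sqrtr_gt0 mulr_gt0// pi_gt0.
  under eq_Rintegral => x _.
    rewrite (_ : expR _ = Num.sqrt (2 * pi) * gauss 1 x); last first.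
      by rewrite /gauss !mulr1 mulVKf.
    over.
  rewrite RintegralZl ?mulKf//.
  by apply: integrableS (integrable_gauss ltr01).
(* Numerator and denominator become sums over the lengths up to l. Length 0 contributes only the
   identity, with value 0. *)
under eq_fun do rewrite num den !natr_sum.
exact: (weighted_cesaro (size_cyclic_words_ge1 R hn)
  (@cyclic_words_fraction_cvg R n j a b hn)).
Qed.
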